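(* Let $D$ be a domain in $\mathbb{C}^n$, let $\mathcal{F}$ be a family of holomorphic functions on $D$, and let $\alpha>0$ be a real number. If the family of functions $$F_\alpha=\left\{z\mapsto \sup_{\|v\|=1}\frac{|(Df(z),v)|}{1+|f(z)|^{\alpha}}\ :\ f\in\mathcal{F}\right\}$$ is locally uniformly bounded in $D$, then $\mathcal{F}$ is normal in $D$.
   Context: For $v=(v_1,\dots,v_n)\in\mathbb{C}^n$, $(Df(z),v)=\sum_{j=1}^n \frac{\partial f}{\partial z_j}(z)\,v_j$; the supremum is over $v$ with Euclidean norm $1$. A family is normal in $D$ if every sequence in it has a subsequence converging locally uniformly in $D$.
   Formalization: ''Normal'' here also allows a subsequence that diverges to infinity locally uniformly in D; with only finite limits the claim fails, e.g. for the family of constants 1, 2, 3, …, whose derivatives all vanish. *)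

(* Defs.v *)
From HB Require Import structures.
From mathcomp Require Import all_boot all_order all_algebra.
From mathcomp Require Import complex.
From mathcomp Require Import all_classical all_reals all_analysis.
Set Implicit Arguments. Unset Strict Implicit. Unset Printing Implicit Defensive.
Import Order.TTheory GRing.Theory Num.Theory.
Import numFieldNormedType.Exports.
Local Open Scope classical_set_scope.
Local Open Scope ring_scope.

Definition cabs (R : realType) (c : R[i]) : R :=
  Num.sqrt (complex.Re c ^+ 2 + complex.Im c ^+ 2).

Definition unit_vec (R : realType) (n : nat) (v : 'rV[R[i]^o]_n) : Prop :=
  Num.sqrt (\sum_(j < n) cabs (v ord0 j) ^+ 2) = 1.

Definition basis_vec (R : realType) (n : nat) (j : 'I_n) : 'rV[R[i]^o]_n :=
  \row_(k < n) (if k == j then 1 else 0).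

Definition partial (R : realType) (n : nat) (f : 'rV[R[i]^o]_n -> R[i]^o)
  (j : 'I_n) (z : 'rV[R[i]^o]_n) : R[i]^o :=
  'D_(basis_vec R j) f z.

Definition Dfv (R : realType) (n : nat) (f : 'rV[R[i]^o]_n -> R[i]^o)
  (z v : 'rV[R[i]^o]_n) : R[i]^o :=
  \sum_(j < n) partial f j z * v ord0 j.

(* Holomorphic on the open set D: complex (Frechet) differentiable at each
   point of D ('rV[R[i]^o]_n is a normed module over the scalar field R[i],
   so the differential is C-linear). *)
Definition holomorphic_on (R : realType) (n : nat) (D : set 'rV[R[i]^o]_n)
  (f : 'rV[R[i]^o]_n -> R[i]^o) : Prop :=
  forall z, D z -> differentiable (f : 'rV[R[i]^o]_n -> R[i]^o) z.

Definition domain (R : realType) (n : nat) (D : set 'rV[R[i]^o]_n) : Prop :=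
  open D /\ connected D.

Definition F_alpha (R : realType) (n : nat) (alpha : R)
  (f : 'rV[R[i]^o]_n -> R[i]^o) (z : 'rV[R[i]^o]_n) : R :=
  sup [set (cabs (Dfv f z v) / (1 + (cabs (f z)) `^ alpha)) | v in unit_vec (n:=n) (R:=R)].

Definition loc_unif_bounded (R : realType) (n : nat) (D : set 'rV[R[i]^o]_n)
  (G : set ('rV[R[i]^o]_n -> R)) : Prop :=
  forall z0, D z0 -> exists M : R,
    \forall z \near z0, D z -> forall g, G g -> g z <= M.

(* Normality in the sense of Montel (locally uniform convergence, allowing
   the limit to be identically infinity). *)
Definition normal_family (R : realType) (n : nat) (D : set 'rV[R[i]^o]_n)
  (F : set ('rV[R[i]^o]_n -> R[i]^o)) : Prop :=
  forall f : nat -> ('rV[R[i]^o]_n -> R[i]^o), (forall k, F (f k)) ->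
  exists phi : nat -> nat, (forall k, (phi k < phi k.+1)%N) /\
   ((exists g : 'rV[R[i]^o]_n -> R[i],
       forall K, compact K -> K `<=` D -> forall eps : R, 0 < eps ->
         \forall k \near \oo, forall z, K z -> cabs (f (phi k) z - g z) < eps)
    \/
    (forall K, compact K -> K `<=` D -> forall M : R,
         \forall k \near \oo, forall z, K z -> M < cabs (f (phi k) z))).

(* Main.v *)
(** On a small ball every member [f] of the family satisfies either [|f| < 2]
    throughout or [|f| > 1] throughout: starting from a value of modulus at most
    1, the bound on [Df / (1 + |f|^alpha)] leaves no time to reach 2.  In the
    second case [ln |f|] is, on complex lines, a positive harmonic function, and
    Harnack's inequality compares its values at any two points of a smaller ball
    by a constant depending on nothing else.  So near each point of [D] a bound
    for [|f|] at one point gives a bound on a whole neighbourhood, uniform in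
    [f].  Along an ultrafilter on the indices of a sequence, the set of points of
    boundedness is therefore open and closed in [D].  If it is [D], the gradient
    bound makes the sequence locally equi-Lipschitz and its ultralimit is locally
    uniform; if it is empty, the sequence tends to infinity locally uniformly.
    The Harnack inequality is derived from a mean value property over circles,
    proved by differentiating under the integral sign. *)

Require Import Defs.
From HB Require Import structures.
From mathcomp Require Import all_boot all_order all_algebra.
From mathcomp Require Import complex.
From mathcomp Require Import all_classical all_reals all_analysis.
From mathcomp Require Import ring lra.
Import Order.TTheory GRing.Theory Num.Theory.
Import numFieldNormedType.Exports.
Local Open Scope classical_set_scope.
Local Open Scope ring_scope.

Set Implicit Arguments.
Unset Strict Implicit.

(** * Integrals depending on a parameter *)

Lemma is_derive_addl (R : realType) (h x : R) : is_derive x 1 (fun y : R => h + y) 1.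
Proof.
have := @is_deriveD R R R (cst h) id x 1 0 1 (is_derive_cst _ _ _) (is_derive_id _ _).
by rewrite add0r.
Qed.

Lemma is_derive_addr (R : realType) (h x : R) : is_derive x 1 (fun y : R => y + h) 1.
Proof.
have := @is_deriveD R R R id (cst h) x 1 1 0 (is_derive_id _ _) (is_derive_cst _ _ _).
by rewrite addr0.
Qed.

Lemma is_derive_continuous (R : realType) (q : R -> R) (x d : R) :
  is_derive x 1 q d -> {for x, continuous q}.
Proof.
by move=> H; apply/differentiable_continuous/derivable1_diffP; exact: ex_derive.
Qed.

Lemma continuous_comp_addl (R : realType) (q : R -> R) (h : R) :
  continuous q -> continuous (fun x => q (h + x)).
Proof.
move=> cq x; apply: (@continuous_comp _ _ _ (fun x => h + x) q); last exact: cq.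
exact: is_derive_continuous (is_derive_addl h x).
Qed.

Lemma integrable_continuous_segment (R : realType) (q : R -> R) (a b : R) :
  continuous q -> (@lebesgue_measure R).-integrable `[a, b] (EFin \o q).
Proof.
move=> cq; apply: continuous_compact_integrable; first exact: segment_compact.
by apply: continuous_subspaceT.
Qed.

Lemma is_derive_under_integral (R : realType) (p p' : R -> R -> R) (a b T B : R) :
  (forall r t : R, a < r < b -> is_derive r 1 (p ^~ t) (p' r t)) ->
  (forall r t, a < r < b -> `|p' r t| <= B) ->
  (forall r, a < r < b -> continuous (p r)) ->
  forall x, a < x < b ->
  is_derive x 1 (fun r => (\int[@lebesgue_measure R]_(t in `[0%R, T]) p r t)%R)
    (\int[@lebesgue_measure R]_(t in `[0%R, T]) p' x t)%R.
Proof.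
move=> dp pB cp x xab.
have E1 y t : a < y < b -> partial1of2 p y t = p' y t.
  by move=> yab; rewrite partial1of2E; have := dp y t yab => ?; apply: derive_val.
have h1 : `]a, b[%classic x by rewrite /= in_itv.
have h2 y : `]a, b[%classic y -> (@lebesgue_measure R).-integrable `[0, T] (EFin \o p y).
  by rewrite /= in_itv /= => yab; apply: integrable_continuous_segment; exact: cp.
have h3 y t : `]a, b[%classic y -> `[0, T]%classic t -> derivable (p ^~ t) y 1.
  by rewrite /= in_itv /= => yab _; have := dp y t yab => -[].
have h4 : forall t : R, 0 <= (fun=> B) t.
  by move=> _; apply: le_trans (pB x 0 xab).
have h5 : (@lebesgue_measure R).-integrable `[0, T] (EFin \o (fun=> B)).
  by apply: (@integrable_continuous_segment R (fun=> B)) => y; exact: cvg_cst.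
have h6 y t : `]a, b[%classic y -> `[0, T]%classic t -> `|partial1of2 p y t| <= (fun=> B) t.
  by rewrite /= in_itv /= => yab _; rewrite E1 // pB.
have mT : measurable (`[0, T]%classic : set (measurableTypeR R)) by exact: measurable_itv.
have D1 := @derivable_under_integral R _ _ (@lebesgue_measure R) p
  `[0, T]%classic mT x a b h1 h2 h3 (fun=> B) h4 h5 h6.
have D2 := @differentiation_under_integral R _ _ (@lebesgue_measure R) p
  `[0, T]%classic mT x a b h1 h2 h3 (fun=> B) h4 h5 h6.
apply: DeriveDef; first exact: D1.
by rewrite -derive1E D2; under eq_Rintegral do rewrite E1 //.
Qed.

(** Since [q'] is only assumed bounded, not continuous, the fundamental theorem is not applied to
    it. Instead the derivative at [h = 0] of the integral of [q (h + x)] over [[0, a]] is computed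
    twice: under the integral sign, and from a primitive [Q] of the continuous function [q]. *)
Lemma integral_derive_bounded (R : realType) (q q' : R -> R) (a B : R) :
  0 < a -> (forall x : R, is_derive x 1 q (q' x)) -> (forall x, `|q' x| <= B) ->
  (\int[@lebesgue_measure R]_(x in `[0%R, a]) q' x)%R = q a - q 0.
Proof.
move=> a0 qd qB.
have [a2 z2 z1] : [/\ -2 < a, (-2 : R) < 0 & (-1 : R) < 0] by split; lra.
have cq : continuous q by move=> x; exact: is_derive_continuous.
(* The primitive starts at -2 so that it is differentiable at every point of [[0, a]] shifted by
   some [h > -1]. *)
pose Q (x : R) : R := (\int[@lebesgue_measure R]_(t in `[(-2)%R, x]) q t)%R.
have Qd (x : R) : -2 < x -> is_derive x 1 Q (q x).
  move=> x2; have [dQ QE] := @continuous_FTC1_closed R q (-2) x (x + 1)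
    ltac:(lra) (integrable_continuous_segment _ _ cq) x2 (cq x).
  by apply: DeriveDef; [exact: dQ | rewrite -derive1E QE].
have shiftE (h : R) : -1 < h ->
    (\int[@lebesgue_measure R]_(x in `[0%R, a]) q (h + x))%R = Q (h + a) - Q h.
  move=> h1; rewrite /Rintegral.
  have dQh (x : R) : 0 <= x -> is_derive x 1 (fun x => Q (h + x)) (q (h + x)).
    move=> x0; have := Qd (h + x) ltac:(lra) => H.
    have H2 := is_derive_addl h x.
    have := @is_derive1_comp R Q (fun x => h + x) x _ _ H H2.
    by rewrite mulr1.
  rewrite (@continuous_FTC2 R (fun x => q (h + x)) (fun x => Q (h + x)) 0 a) //.
  - by rewrite /= addr0.
  - apply: continuous_subspaceT => x; exact: continuous_comp_addl.
  - split.
    + by move=> x; rewrite in_itv /= => /andP[x0 _]; have := dQh x (ltW x0) => -[].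
    + by apply: cvg_at_right_filter; exact: is_derive_continuous (dQh 0 (lexx _)).
    + by apply: cvg_at_left_filter; exact: is_derive_continuous (dQh a (ltW a0)).
  - move=> x; rewrite in_itv /= => /andP[x0 _]; rewrite derive1E.
    by have := dQh x (ltW x0) => -[].
have d1 (x y : R) : is_derive x 1 (fun x => q (x + y)) (q' (x + y)).
  have H2 := is_derive_addr y x.
  have := @is_derive1_comp R q (fun x => x + y) x _ _ (qd (x + y)) H2.
  by rewrite mulr1.
have B1 : -1 < (0 : R) < 1 by rewrite z1 ltr01.
have := @is_derive_under_integral R (fun h x => q (h + x)) (fun h x => q' (h + x)) (-1) 1 a B
  (fun h x _ => d1 h x) (fun h x _ => qB (h + x))
  (fun h _ => continuous_comp_addl (h := h) cq) 0 B1.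
under [X in is_derive _ _ _ X -> _]eq_Rintegral do rewrite add0r.
move=> /@derive_val <-.
have D : is_derive (0:R) 1 (fun h => Q (h + a) - Q h) (q a - q 0).
  have H1 := Qd a a2; have H0 := Qd 0 z2.
  have H2 := is_derive_addr a 0.
  have H3 := @is_derive1_comp R Q (fun x => x + a) 0 (q (0 + a)) 1.
  rewrite add0r mulr1 in H3; have {}H3 := H3 H1 H2.
  exact: (is_deriveB H3 H0).
rewrite -(@derive_val _ _ _ _ _ _ _ D); apply: near_eq_derive.
have : \forall h \near (0:R), -1 < h by exact: lt_nbhsr.
by apply: filterS => h; exact: shiftE.
Qed.

(** The [r]-derivative of [p] and the [t]-derivative of [q] are the same function [p'], as in the
    Cauchy-Riemann equations. So the derivative of the mean of [p] is the integral of a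
    [t]-derivative, and it vanishes because [q r] takes equal values at 0 and [T]. *)
Lemma periodic_mean_constant (R : realType) (p p' q : R -> R -> R) (a b T B : R) :
  0 < T ->
  (forall r t : R, a < r < b -> is_derive r 1 (p ^~ t) (p' r t)) ->
  (forall r t : R, a < r < b -> is_derive t 1 (q r) (p' r t)) ->
  (forall r t, a < r < b -> `|p' r t| <= B) ->
  (forall r, a < r < b -> continuous (p r)) ->
  (forall r, a < r < b -> q r T = q r 0) ->
  forall r s, a < r -> r < s -> s < b ->
  (\int[@lebesgue_measure R]_(t in `[0%R, T]) p r t)%R =
  (\int[@lebesgue_measure R]_(t in `[0%R, T]) p s t)%R.
Proof.
move=> T0 dp dq pB cp qT r s ar rs sb.
pose A (r : R) := (\int[@lebesgue_measure R]_(t in `[0%R, T]) p r t)%R.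
suff dA (x : R) : a < x < b -> is_derive x 1 A 0.
  have rsP x : x \in `[r, s] -> a < x < b.
    by rewrite in_itv /= => /andP[rx xs]; apply/andP; split; lra.
  have [x xrs||x _] := @MVT_segment R A (fun=> 0) r s (ltW rs).
  - by apply/dA/rsP; apply: subset_itv_oo_cc xrs.
  - apply/continuous_in_subspaceT => x /[!inE] xrs.
    by apply: is_derive_continuous (dA x _); exact: rsP.
  by rewrite mul0r => /eqP; rewrite subr_eq0 => /eqP.
move=> xab.
apply: (is_derive_eq (@is_derive_under_integral R p p' a b T B dp pB cp x xab)).
by rewrite (@integral_derive_bounded R (q x) (p' x) T B T0 (fun t => dq x t xab)
  (fun t => pB x t xab)) qT // subrr.
Qed.

(** * Complex derivatives along real curves *)

Section ComplexModulus.
Context {R : realType}.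
Implicit Types z w : R[i].

Lemma cabsE z : (cabs z)%:C%C = `|z|.
Proof. by rewrite normc_def. Qed.

Lemma cabs_ge0 z : 0 <= cabs z.
Proof. exact: sqrtr_ge0. Qed.

Lemma cabsM z w : cabs (z * w) = cabs z * cabs w.
Proof. by apply: complexI; rewrite rmorphM /= !cabsE normrM. Qed.

Lemma cabsN z : cabs (- z) = cabs z.
Proof. by apply: complexI; rewrite !cabsE normrN. Qed.

Lemma cabsB z w : cabs (z - w) = cabs (w - z).
Proof. by rewrite -cabsN opprB. Qed.

Lemma cabsV z : cabs z^-1 = (cabs z)^-1.
Proof. by apply: complexI; rewrite fmorphV /= !cabsE normfV. Qed.

Lemma cabs0 : cabs (0 : R[i]) = 0.
Proof. by apply: complexI; rewrite cabsE normr0. Qed.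

Lemma cabs1 : cabs (1 : R[i]) = 1.
Proof. by apply: complexI; rewrite cabsE normr1. Qed.

Lemma cabs_eq0 z : (cabs z == 0) = (z == 0).
Proof. by rewrite -(inj_eq (@complexI R)) cabsE normr_eq0. Qed.

Lemma cabs_gt0 z : (0 < cabs z) = (z != 0).
Proof. by rewrite lt0r cabs_eq0 cabs_ge0 andbT. Qed.

Lemma ler_cabsD z w : cabs (z + w) <= cabs z + cabs w.
Proof. by rewrite -lecR rmorphD /= !cabsE ler_normD. Qed.

Lemma ler_cabs_dist z w y : cabs (z - w) <= cabs (z - y) + cabs (y - w).
Proof. by rewrite (_ : z - w = (z - y) + (y - w)) ?ler_cabsD // addrA subrK. Qed.

Lemma ler_cabs_sum (I : finType) (F : I -> R[i]) :
  cabs (\sum_i F i) <= \sum_i cabs (F i).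
Proof.
by elim/big_ind2: _ => [|x u y v xu yv|i _]; rewrite ?cabs0 //;
  exact: le_trans (ler_cabsD _ _) (lerD xu yv).
Qed.

Lemma cabs_real (x : R) : cabs x%:C%C = `|x|.
Proof. by rewrite /cabs /= expr0n addr0 sqrtr_sqr. Qed.

Lemma sqr_cabs z : cabs z ^+ 2 = complex.Re z ^+ 2 + complex.Im z ^+ 2.
Proof. by rewrite sqr_sqrtr // addr_ge0 // sqr_ge0. Qed.

Lemma ler_Re_cabs z : `|complex.Re z| <= cabs z.
Proof. by rewrite -sqrtr_sqr ler_sqrt ?addr_ge0 ?sqr_ge0 // lerDl sqr_ge0. Qed.

Lemma ler_Im_cabs z : `|complex.Im z| <= cabs z.
Proof. by rewrite -sqrtr_sqr ler_sqrt ?addr_ge0 ?sqr_ge0 // lerDr sqr_ge0. Qed.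

Lemma cabs_le_Re_Im z : cabs z <= `|complex.Re z| + `|complex.Im z|.
Proof.
rewrite -(ler_pXn2r (n := 2)) ?nnegrE ?cabs_ge0 ?addr_ge0 //.
rewrite sqr_cabs sqrrD !real_normK ?num_real // lerD2r lerDl mulrn_wge0 // mulr_ge0.
Qed.

Lemma ReM z w : complex.Re (z * w) =
  complex.Re z * complex.Re w - complex.Im z * complex.Im w.
Proof. by case: z w => [a b] [c d]. Qed.

Lemma ImM z w : complex.Im (z * w) =
  complex.Re z * complex.Im w + complex.Im z * complex.Re w.
Proof. by case: z w => [a b] [c d]. Qed.

Lemma ReD z w : complex.Re (z + w) = complex.Re z + complex.Re w.
Proof. by case: z w => [a b] [c d]. Qed.

Lemma ImD z w : complex.Im (z + w) = complex.Im z + complex.Im w.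
Proof. by case: z w => [a b] [c d]. Qed.

Lemma ReN z : complex.Re (- z) = - complex.Re z.
Proof. by case: z. Qed.

Lemma ImN z : complex.Im (- z) = - complex.Im z.
Proof. by case: z. Qed.

Lemma ReV z : complex.Re z^-1 = complex.Re z / (complex.Re z ^+ 2 + complex.Im z ^+ 2).
Proof. by case: z. Qed.

Lemma ImV z : complex.Im z^-1 = - complex.Im z / (complex.Re z ^+ 2 + complex.Im z ^+ 2).
Proof. by case: z => a b /=; rewrite mulNr. Qed.

Lemma eq_Re_Im z w : complex.Re z = complex.Re w -> complex.Im z = complex.Im w -> z = w.
Proof. by case: z w => [a b] [c d] /= -> ->. Qed.

End ComplexModulus.

(** A first-order expansion avoids the quotient and its exclusion of [h = 0], so it can be composed
    and estimated by moduli. *)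
Lemma is_derive_littleo (R : realType) (q : R -> R) (x d : R) :
  is_derive x 1 q d <->
  forall e, 0 < e -> exists2 r, 0 < r &
    forall h, `|h| < r -> `|q (x + h) - q x - h * d| <= e * `|h|.
Proof.
split.
  move=> dq e e0.
  have /cvgrPdist_le /(_ e e0) : (h^-1 *: (q (h *: 1 + x) - q x)) @[h --> (0 : R)^'] --> d.
    by rewrite -(derive_val (is_derive := dq)); exact: (ex_derive (is_derive := dq)).
  move=> [r /= r0 H]; exists r => // h hr.
  have [->|h0] := eqVneq h 0; first by rewrite addr0 subrr mul0r subrr normr0 mulr0.
  have := H h; rewrite /= sub0r normrN => /(_ hr h0).
  rewrite /GRing.scale /= mulr1 (addrC h) distrC => H1.
  rewrite (_ : _ - h * d = (h^-1 * (q (x + h) - q x) - d) * h); last by field.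
  by rewrite normrM ler_wpM2r.
move=> H; have lim : (h^-1 *: (q (h *: 1 + x) - q x)) @[h --> (0 : R)^'] --> d.
  apply/cvgrPdist_le => e e0; have [r r0 Hr] := H e e0.
  exists r => // h /=; rewrite sub0r normrN => hr h0.
  rewrite /GRing.scale /= mulr1 (addrC h) distrC.
  rewrite (_ : _ - d = (q (x + h) - q x - h * d) / h); last by field.
  by rewrite normrM normfV ler_pdivrMr ?normr_gt0 // Hr.
apply: DeriveDef; first by apply/cvg_ex; exists d.
exact/cvg_lim.
Qed.

Definition is_cderive (R : realType) (g : R -> R[i]) (t : R) (d : R[i]) : Prop :=
  is_derive t 1 (fun s => complex.Re (g s)) (complex.Re d) /\
  is_derive t 1 (fun s => complex.Im (g s)) (complex.Im d).

(* Complex differentiability tested along differentiable real curves: this makes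
   the chain rule definitional and reduces all computations to [is_derive]. *)
Definition is_cdiff (R : realType) (F : R[i] -> R[i]) (z c : R[i]) : Prop :=
  forall (g : R -> R[i]) t d, g t = z -> is_cderive g t d ->
    is_cderive (F \o g) t (c * d).

Section ComplexDerivative.
Context {R : realType}.
Implicit Types (g : R -> R[i]) (F G : R[i] -> R[i]) (z c d : R[i]) (t : R).

Lemma is_cderive_littleo g t d :
  is_cderive g t d <->
  forall e, 0 < e -> exists2 r, 0 < r &
    forall h, `|h| < r -> cabs (g (t + h) - g t - h%:C%C * d) <= e * `|h|.
Proof.
split=> [[/is_derive_littleo HR /is_derive_littleo HI] e e0|H].
  have e20 : 0 < e / 2 by rewrite divr_gt0.
  have [r1 r10 H1] := HR _ e20; have [r2 r20 H2] := HI _ e20.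
  exists (Num.min r1 r2) => [|h]; first by rewrite lt_min r10.
  rewrite lt_min => /andP[hr1 hr2]; apply: le_trans (cabs_le_Re_Im _) _.
  have := lerD (H1 _ hr1) (H2 _ hr2).
  rewrite -mulrDl -splitr; apply: le_trans.
  by rewrite !(ReD, ImD, ReN, ImN, ReM, ImM) /= !mul0r subr0 addr0.
split; apply/is_derive_littleo => e /H[r r0 Hr]; exists r => // h /Hr; apply: le_trans.
  apply: le_trans (ler_Re_cabs _).
  by rewrite !(ReD, ReN, ReM) /= mul0r subr0.
apply: le_trans (ler_Im_cabs _).
by rewrite !(ImD, ImN, ImM) /= mul0r addr0.
Qed.

Lemma is_cderive_eq g t d d' : is_cderive g t d -> d = d' -> is_cderive g t d'.
Proof. by move=> + <-. Qed.

Lemma is_cderiveD g1 g2 t d1 d2 : is_cderive g1 t d1 -> is_cderive g2 t d2 ->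
  is_cderive (fun s => g1 s + g2 s) t (d1 + d2).
Proof.
move=> [R1 I1] [R2 I2]; split.
  by under eq_fun do rewrite ReD; rewrite ReD; exact: is_deriveD.
by under eq_fun do rewrite ImD; rewrite ImD; exact: is_deriveD.
Qed.

Lemma is_cderiveM g1 g2 t d1 d2 : is_cderive g1 t d1 -> is_cderive g2 t d2 ->
  is_cderive (fun s => g1 s * g2 s) t (g1 t * d2 + d1 * g2 t).
Proof.
move=> [R1 I1] [R2 I2]; split.
  under eq_fun do rewrite ReM.
  apply: (is_derive_eq (is_deriveB (is_deriveM R1 R2) (is_deriveM I1 I2))).
  by rewrite !(ReD, ReM) /GRing.scale /=; ring.
under eq_fun do rewrite ImM.
apply: (is_derive_eq (is_deriveD (is_deriveM R1 I2) (is_deriveM I1 R2))).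
by rewrite !(ImD, ImM) /GRing.scale /=; ring.
Qed.

Lemma is_cderive_cst c t : is_cderive (fun=> c) t 0.
Proof. by split; exact: is_derive_cst. Qed.

(** Ordinary complex differentiability implies the version along curves: the error of [F] at the
    increment [k] of the curve, and the error of the curve itself multiplied by [c], each take half
    of [e]. *)
Lemma is_cdiff_littleo F z c :
  (forall e, 0 < e -> exists2 r, 0 < r &
    forall h, cabs h < r -> cabs (F (z + h) - F z - h * c) <= e * cabs h) ->
  is_cdiff F z c.
Proof.
move=> H g t d gt /is_cderive_littleo Hg; apply/is_cderive_littleo => e e0.
(* [A] bounds the increment of the curve per unit of [h] once its remainder is at most [|h|]; [B] is
   a positive bound for [cabs c]. *)
pose A := cabs d + 1; pose B := cabs c + 1.
have A0 : 0 < A by rewrite ltr_wpDl ?cabs_ge0.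
have B0 : 0 < B by rewrite ltr_wpDl ?cabs_ge0.
have [r r0 Hr] := H (e / 2 / A) ltac:(by rewrite !divr_gt0).
have [r1 r10 Hr1] := Hg (Num.min 1 (e / 2 / B)) ltac:(by rewrite lt_min ltr01 !divr_gt0).
exists (Num.min r1 (r / A)) => [|h]; first by rewrite lt_min r10 divr_gt0.
rewrite lt_min => /andP[hr1 hr]; have := Hr1 _ hr1.
set k := g (t + h) - g t => Hk.
have kA : cabs k <= A * `|h|.
  rewrite (_ : k = h%:C%C * d + (k - h%:C%C * d)); last by rewrite addrC subrK.
  apply: le_trans (ler_cabsD _ _) _; rewrite cabsM cabs_real /A mulrDl mul1r.
  rewrite mulrC lerD2l; apply: le_trans Hk _.
  by rewrite ler_piMl // ge_min lexx.
have kr : cabs k < r.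
  by apply: le_lt_trans kA _; rewrite mulrC -ltr_pdivlMr.
have := Hr _ kr; rewrite (_ : z + k = g (t + h)); last by rewrite /k -gt addrC subrK.
rewrite -gt => Fk.
rewrite /= (_ : _ - _ = (F (g (t + h)) - F (g t) - k * c) + c * (k - h%:C%C * d)); last by ring.
apply: le_trans (ler_cabsD _ _) _; rewrite cabsM.
rewrite (_ : e * `|h| = e / 2 * `|h| + e / 2 * `|h|); last by field.
apply: lerD.
  apply: le_trans Fk _; rewrite -mulrA ler_pM2l ?divr_gt0 //.
  by rewrite ler_pdivrMl.
apply: (@le_trans _ _ (B * (e / 2 / B * `|h|))).
  apply: ler_pM; rewrite ?cabs_ge0 ?lerDl //; apply: le_trans Hk _.
  by rewrite ler_wpM2r // ge_min lexx orbT.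
by rewrite mulrA (mulrC B) divfK // gt_eqF.
Qed.

Lemma is_cdiff_eq F z c c' : is_cdiff F z c -> c = c' -> is_cdiff F z c'.
Proof. by move=> + <-. Qed.

Lemma is_cdiff_cst c z : is_cdiff (fun=> c) z 0.
Proof. by move=> g t d _ _; rewrite mul0r; exact: is_cderive_cst. Qed.

Lemma is_cdiff_id z : is_cdiff id z 1.
Proof. by move=> g t d _; rewrite mul1r. Qed.

Lemma is_cdiff_comp F G z c d : is_cdiff G z d -> is_cdiff F (G z) c ->
  is_cdiff (F \o G) z (c * d).
Proof.
move=> dG dF g t e gz dg; rewrite -mulrA; apply: dF; first by rewrite /= gz.
exact: dG.
Qed.

Lemma is_cdiffD F G z c d : is_cdiff F z c -> is_cdiff G z d ->
  is_cdiff (fun w => F w + G w) z (c + d).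
Proof.
by move=> dF dG g t e gz dg; rewrite mulrDl; apply: is_cderiveD; [exact: dF|exact: dG].
Qed.

Lemma is_cdiffM F G z c d : is_cdiff F z c -> is_cdiff G z d ->
  is_cdiff (fun w => F w * G w) z (F z * d + c * G z).
Proof.
move=> dF dG g t e gz dg.
apply: (is_cderive_eq (is_cderiveM (dF _ _ _ gz dg) (dG _ _ _ gz dg))).
by rewrite /= gz; ring.
Qed.

Lemma is_cdiff_sum (I : Type) (r : seq I) (F : I -> R[i] -> R[i]) z (c : I -> R[i]) :
  (forall i, is_cdiff (F i) z (c i)) ->
  is_cdiff (fun w => \sum_(i <- r) F i w) z (\sum_(i <- r) c i).
Proof.
move=> dF; elim: r => [|i r IH].
  by under eq_fun do rewrite big_nil; rewrite big_nil; exact: is_cdiff_cst.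
by under eq_fun do rewrite big_cons; rewrite big_cons; exact: is_cdiffD.
Qed.

Lemma is_cdiffV z : z != 0 -> is_cdiff (@GRing.inv R[i]) z (- z ^- 2).
Proof.
move=> z0 g t d gz [dR dI].
have n0 : complex.Re z ^+ 2 + complex.Im z ^+ 2 != 0.
  by rewrite -sqr_cabs sqrf_eq0 cabs_eq0.
have dn := is_deriveD (is_deriveM dR dR) (is_deriveM dI dI).
have n0' : ((fun s => complex.Re (g s)) * (fun s => complex.Re (g s)) +
  (fun s => complex.Im (g s)) * (fun s => complex.Im (g s))) t != 0.
  by rewrite !fctE gz -!expr2.
have dV := is_deriveV n0' dn.
have cE : - z ^- 2 = - (z^-1 * z^-1) by rewrite -expr2 exprVn.
split.
  under eq_fun do rewrite /= ReV !expr2.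
  apply: (is_derive_eq (is_deriveM dR dV)).
  rewrite cE !(ReM, ReN, ImN, ImM, ReV, ImV) /GRing.scale /= !fctE gz.
  by field; exact: n0.
under eq_fun do rewrite /= ImV !expr2.
apply: (is_derive_eq (is_deriveM (is_deriveN dI) dV)).
rewrite cE !(ReM, ReN, ImN, ImM, ReV, ImV) /GRing.scale /= !fctE gz.
by field; exact: n0.
Qed.

(** The principal logarithm on the right half-plane; the arctangent is the principal argument only
    where the real part is positive. *)
Definition clog z : R[i] :=
  Complex (ln (complex.Re z ^+ 2 + complex.Im z ^+ 2) / 2) (atan (complex.Im z / complex.Re z)).

Lemma is_cdiff_clog z : 0 < complex.Re z -> is_cdiff clog z z^-1.
Proof.
move=> z0 g t d gz [dR dI].
have n0 : 0 < complex.Re z ^+ 2 + complex.Im z ^+ 2.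
  by rewrite ltr_pwDl ?exprn_gt0 ?sqr_ge0.
have dn := is_deriveD (is_deriveM dR dR) (is_deriveM dI dI).
have n0' : 0 < ((fun s => complex.Re (g s)) * (fun s => complex.Re (g s)) +
  (fun s => complex.Im (g s)) * (fun s => complex.Im (g s))) t.
  by rewrite !fctE gz -!expr2.
have R0 : (fun s => complex.Re (g s)) t != 0 by rewrite gz gt_eqF.
split.
  rewrite /=; under eq_fun do rewrite !expr2 mulrC.
  apply: (is_derive_eq (is_deriveZ 2^-1 (is_derive1_comp (is_derive1_ln n0') dn))).
  rewrite !(ReM, ReV, ImV) /GRing.scale /= !fctE gz.
  by field; rewrite gt_eqF.
apply: (is_derive_eq (is_derive1_comp (is_derive1_atan _) (is_deriveM dI (is_deriveV R0 dR)))).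
rewrite !(ImM, ReV, ImV) /GRing.scale /= !fctE gz.
by field; rewrite !gt_eqF.
Qed.

Lemma Re_clog z : z != 0 -> complex.Re (clog z) = ln (cabs z).
Proof.
by move=> z0; rewrite /= -sqr_cabs lnXn ?cabs_gt0 // mulr2n; field.
Qed.

End ComplexDerivative.

(** * Holomorphic logarithms and means over circles *)

Section HolomorphicLog.
Context {R : realType}.
Implicit Types (F M : R[i] -> R[i]) (z w c d x y : R[i]) (t r s B : R).

Lemma is_cderive_line x y t : is_cderive (fun s => x + s%:C%C * y) t y.
Proof.
have dR : is_cderive (fun s => s%:C%C) t 1.
  by split; [exact: is_derive_id|exact: is_derive_cst].
apply: (is_cderive_eq (is_cderiveD (is_cderive_cst x t)
  (is_cderiveM dR (is_cderive_cst y t)))).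
by rewrite mulr0 add0r mul1r add0r.
Qed.

(** The derivative is bounded on the open interval only: in the growth argument below the bound is
    known only before the modulus reaches 2. *)
Lemma MVT_segment01 (q q' : R -> R) B :
  (forall t, 0 <= t <= 1 -> is_derive t 1 q (q' t)) ->
  (forall t, 0 < t < 1 -> `|q' t| <= B) -> `|q 1 - q 0| <= B.
Proof.
move=> dq qB.
have [t||t] := @MVT R q q' 0 1 ltr01.
- by rewrite in_itv /= => /andP[t0 t1]; apply: dq; rewrite !ltW.
- apply/continuous_in_subspaceT => t; rewrite inE /= in_itv /= => t01.
  exact: is_derive_continuous (dq t t01).
- by rewrite in_itv /= => t01 ->; rewrite subr0 mulr1 qB.
Qed.

(** The mean value theorem is applied to the real and imaginary parts separately, whence the factor
    2. *)
Lemma is_cdiff_lipschitz F F' x y B :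
  (forall t, 0 <= t <= 1 -> is_cdiff F (x + t%:C%C * (y - x)) (F' (x + t%:C%C * (y - x)))) ->
  (forall t, 0 <= t <= 1 -> cabs (F' (x + t%:C%C * (y - x))) <= B) ->
  cabs (F y - F x) <= 2 * B * cabs (y - x).
Proof.
move=> dF FB.
pose g t := x + t%:C%C * (y - x).
have dFg t : 0 <= t <= 1 -> is_cderive (F \o g) t (F' (g t) * (y - x)).
  by move=> t01; apply: dF => //; exact: is_cderive_line.
have FgB t : 0 < t < 1 -> cabs (F' (g t) * (y - x)) <= B * cabs (y - x).
  move=> /andP[t0 t1]; have t01 : 0 <= t <= 1 by rewrite !ltW.
  by rewrite cabsM ler_wpM2r ?cabs_ge0 // FB.
have HR := @MVT_segment01 (fun t => complex.Re ((F \o g) t))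
  (fun t => complex.Re (F' (g t) * (y - x))) (B * cabs (y - x))
  (fun t t01 => proj1 (dFg t t01))
  (fun t t01 => le_trans (ler_Re_cabs _) (FgB t t01)).
have HI := @MVT_segment01 (fun t => complex.Im ((F \o g) t))
  (fun t => complex.Im (F' (g t) * (y - x))) (B * cabs (y - x))
  (fun t t01 => proj2 (dFg t t01))
  (fun t t01 => le_trans (ler_Im_cabs _) (FgB t t01)).
have g0 : g 0 = x by rewrite /g mul0r addr0.
have g1 : g 1 = y by rewrite /g mul1r addrC subrK.
move: HR HI; rewrite /= g0 g1 => HR HI.
apply: le_trans (cabs_le_Re_Im _) _; rewrite ReD ImD ReN ImN.
by rewrite -mulrA mulr_natl mulr2n lerD.
Qed.

Lemma is_cdiff_disc_bound F F' B :
  (forall z, cabs z < 2 -> is_cdiff F z (F' z)) ->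
  (forall z, cabs z < 2 -> cabs (F' z) <= B) -> F 0 = 0 ->
  forall z, cabs z < 2 -> cabs (F z) <= 4 * B.
Proof.
move=> dF FB F0 z z2.
have B0 : 0 <= B by apply: le_trans (FB z z2); exact: cabs_ge0.
have seg t : 0 <= t <= 1 -> cabs (0 + t%:C%C * (z - 0)) < 2.
  move=> /andP[t0 t1]; rewrite subr0 add0r cabsM cabs_real ger0_norm //.
  by apply: le_lt_trans z2; rewrite ler_piMl ?cabs_ge0.
have := @is_cdiff_lipschitz F F' 0 z B
  (fun t t01 => dF _ (seg t t01)) (fun t t01 => FB _ (seg t t01)).
rewrite F0 !subr0 => /le_trans; apply.
rewrite (_ : 4 * B = 2 * B * 2); last by ring.
by rewrite ler_wpM2l ?mulr_ge0 // ltW.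
Qed.

Lemma is_cdiff_clog_div F G z c d : F z != 0 -> G z != 0 ->
  0 < complex.Re (F z / G z) -> is_cdiff F z c -> is_cdiff G z d ->
  is_cdiff (fun w => clog (F w / G w)) z (c / F z - d / G z).
Proof.
move=> F0 G0 FG dF dG.
have dV := is_cdiff_comp dG (is_cdiffV G0).
have dFG := is_cdiffM dF dV.
apply: (is_cdiff_eq (is_cdiff_comp dFG (is_cdiff_clog FG))).
by rewrite /=; field; rewrite F0 G0.
Qed.

Lemma Re_div_gt0 z w : w != 0 -> cabs (z - w) < cabs w -> 0 < complex.Re (z / w).
Proof.
move=> w0 zw; have : cabs (z / w - 1) < 1.
  rewrite (_ : z / w - 1 = (z - w) / w); last by rewrite mulrBl divff.
  by rewrite cabsM cabsV ltr_pdivrMr ?cabs_gt0 // mul1r.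
move=> /(le_lt_trans (ler_Re_cabs _)); rewrite ReD ReN /= ltr_norml => /andP[+ _].
by rewrite ltrBrDl subrr.
Qed.

(* The logarithm of [F z / F 0] is a finite telescoping sum of principal
   logarithms of the ratios [F ((j + 1) z / m) / F (j z / m)], all close to 1. *)
Lemma holomorphic_log F F' B :
  (forall z, cabs z < 2 -> is_cdiff F z (F' z)) ->
  (forall z, cabs z < 2 -> 1 < cabs (F z)) ->
  (forall z, cabs z < 2 -> cabs (F' z) <= B) ->
  exists L : R[i] -> R[i], [/\ L 0 = 0,
    forall z, cabs z < 2 -> is_cdiff L z (F' z / F z) &
    forall z, cabs z < 2 -> complex.Re (L z) = ln (cabs (F z)) - ln (cabs (F 0))].
Proof.
move=> dF F1 FB.
have B0 : 0 <= B by apply: le_trans (FB 0 _); rewrite ?cabs_ge0 // cabs0 ltr0n.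
(* With this [m], consecutive values of [F] along the subdivided segment differ by at most
   [2 * B * 2 / (m + 1) <= 1], hence by less than the modulus of [F], so their ratio has positive
   real part. *)
have [m mB] : exists m : nat, 4 * B < m.+1%:R.
  exists (Num.truncn (4 * B)); have /andP[_] := truncn_itv (mulr_ge0 (ler0n R 4) B0).
  by [].
pose l (j : nat) : R[i] := ((j%:R / m.+1%:R) : R)%:C%C.
have m0 : (0 : R) < m.+1%:R by rewrite ltr0n.
have lE j : cabs (l j) = j%:R / m.+1%:R.
  by rewrite cabs_real ger0_norm // divr_ge0 // ler0n.
have lz j z : (j <= m.+1)%N -> cabs z < 2 -> cabs (l j * z) < 2.
  move=> jm z2; rewrite cabsM lE; apply: le_lt_trans z2.
  by rewrite ler_piMl ?cabs_ge0 // ler_pdivrMr // mul1r ler_nat.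
have Fn0 z : cabs z < 2 -> F z != 0.
  by move=> z2; rewrite -cabs_gt0; apply: lt_trans (F1 z z2).
have lS j : l j.+1 = l j + ((m.+1%:R)^-1 : R)%:C%C.
  by rewrite /l -rmorphD /= -natr1 mulrDl mul1r.
have ratio j z : (j < m.+1)%N -> cabs z < 2 ->
    0 < complex.Re (F (l j.+1 * z) / F (l j * z)).
  move=> jm z2; have jz := lz j z (ltnW jm) z2.
  apply: Re_div_gt0; first exact: Fn0.
  apply: le_lt_trans (F1 _ jz).
  have seg t : 0 <= t <= 1 -> cabs (l j * z + t%:C%C * (l j.+1 * z - l j * z)) < 2.
    move=> /andP[t0 t1]; rewrite lS.
    rewrite (_ : _ + _ = ((j%:R + t) / m.+1%:R)%:C%C * z); last first.
      rewrite (_ : ((j%:R + t) / m.+1%:R)%:C%C = l j + t%:C%C * ((m.+1%:R)^-1 : R)%:C%C); first by ring.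
      by rewrite /l -rmorphM -rmorphD /= mulrDl.
    rewrite cabsM cabs_real ger0_norm ?divr_ge0 ?addr_ge0 ?ler0n //.
    apply: le_lt_trans z2; rewrite ler_piMl ?cabs_ge0 // ler_pdivrMr // mul1r.
    by apply: le_trans (lerD (lexx _) t1) _; rewrite natr1 ler_nat.
  have := @is_cdiff_lipschitz F F' (l j * z) (l j.+1 * z) B
    (fun t t01 => dF _ (seg t t01)) (fun t t01 => FB _ (seg t t01)).
  move=> /le_trans; apply.
  rewrite (_ : l j.+1 * z - l j * z = ((m.+1%:R)^-1 : R)%:C%C * z); last by rewrite lS; ring.
  rewrite cabsM cabs_real ger0_norm ?invr_ge0 ?ler0n //.
  rewrite mulrCA ler_pdivrMl // mulr1.
  apply: le_trans (ltW mB); rewrite mulrAC (_ : 4 = 2 * 2); last by ring.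
  by rewrite ler_wpM2r // ler_wpM2l // ltW.
pose L z := \sum_(j < m.+1) clog (F (l j.+1 * z) / F (l j * z)).
have l0 : l 0%N = 0 by rewrite /l mul0r.
have lm : l m.+1 = 1 by rewrite /l divff // gt_eqF.
exists L; split.
- rewrite /L big1 // => j _; rewrite !mulr0 divff; last by apply: Fn0; rewrite cabs0 ltr0n.
  apply: eq_Re_Im; rewrite /=; last by rewrite mul0r atan0.
  by rewrite expr1n expr0n addr0 ln1 mul0r.
- move=> z z2.
  (* Each logarithm contributes a difference of consecutive [a j]; the factor [l j] from the chain
     rule makes [a 0] vanish, and [F' z / F z] remains at the other end. *)
  pose a j := F' (l j * z) * l j / F (l j * z).
  apply: (@is_cdiff_eq _ _ _ (\sum_(j < m.+1) (a j.+1 - a j))); last first.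
    rewrite -(big_mkord xpredT (fun j => a j.+1 - a j)) telescope_sumr //.
    by rewrite /a lm l0 mul1r mulr1 mulr0 mul0r subr0.
  apply: is_cdiff_sum => j.
  have dl k : (k <= m.+1)%N -> is_cdiff (fun w => F (l k * w)) z (F' (l k * z) * l k).
    move=> km; have H := is_cdiffM (@is_cdiff_cst _ (l k) z) (@is_cdiff_id _ z).
    rewrite mulr1 mul0r addr0 in H.
    exact: (is_cdiff_comp H (dF _ (lz k z km z2))).
  apply: is_cdiff_clog_div.
  + exact/Fn0/lz.
  + by apply/Fn0/lz => //; exact: ltnW.
  + exact: ratio.
  + exact: dl.
  + by apply: dl; exact: ltnW.
- move=> z z2.
  pose a j := ln (cabs (F (l j * z))).
  rewrite /L (big_morph _ (@ReD R) (erefl : complex.Re (0 : R[i]) = 0)).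
  transitivity (\sum_(j < m.+1) (a j.+1 - a j)); last first.
    rewrite -(big_mkord xpredT (fun j => a j.+1 - a j)) telescope_sumr //.
    by rewrite /a lm l0 mul1r mul0r.
  apply: eq_bigr => j _.
  have j0 : F (l j * z) != 0 by apply/Fn0/lz => //; exact: ltnW.
  have j1 : F (l j.+1 * z) != 0 by exact/Fn0/lz.
  rewrite Re_clog ?mulf_neq0 ?invr_eq0 // cabsM cabsV.
  by rewrite ln_div ?posrE ?cabs_gt0.
Qed.

Lemma ReM_real z t : complex.Re (z * t%:C%C) = complex.Re z * t.
Proof. by rewrite ReM /= mulr0 subr0. Qed.

Definition cis t : R[i] := Complex (cos t) (sin t).

Lemma cabs_cis t : cabs (cis t) = 1.
Proof. by rewrite /cabs /= cos2Dsin2 sqrtr1. Qed.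

Lemma cis_neq0 t : cis t != 0.
Proof. by rewrite -cabs_gt0 cabs_cis ltr01. Qed.

Lemma is_cderive_cis t : is_cderive cis t (Complex 0 1 * cis t).
Proof.
split; first by apply: (is_derive_eq (is_derive_cos t)); rewrite ReM /= mul0r mul1r sub0r.
by apply: (is_derive_eq (is_derive_sin t)); rewrite ImM /= mul0r mul1r add0r.
Qed.

Lemma is_cderive_radius t r : is_cderive (fun s => s%:C%C * cis t) r (cis t).
Proof.
by have := is_cderive_line 0 (cis t) r; under eq_fun do rewrite add0r.
Qed.

Lemma is_cderive_angle r t : is_cderive (fun s => r%:C%C * cis s) t (Complex 0 1 * (r%:C%C * cis t)).
Proof.
apply: (is_cderive_eq (is_cderiveM (is_cderive_cst _ _) (is_cderive_cis t))).
by rewrite mul0r addr0; ring.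
Qed.

Lemma cabs_polar r t : 0 <= r -> cabs (r%:C%C * cis t) = r.
Proof. by move=> r0; rewrite cabsM cabs_cis mulr1 cabs_real ger0_norm. Qed.

(** In polar coordinates the Cauchy-Riemann equations say that the radial derivative of the real
    part of [F] is [1 / r] times the angular derivative of its imaginary part. The domain is an
    annulus because the lemma is applied to [M z / z]. *)
Lemma circle_mean_constant F F' a b B : 0 <= a ->
  (forall z, a < cabs z < b -> is_cdiff F z (F' z)) ->
  (forall z, a < cabs z < b -> cabs (F' z) <= B) ->
  forall r s, a < r -> r < s -> s < b ->
  (\int[@lebesgue_measure R]_(t in `[0%R, (2 * pi)%R]) complex.Re (F (r%:C%C * cis t)))%R =
  (\int[@lebesgue_measure R]_(t in `[0%R, (2 * pi)%R]) complex.Re (F (s%:C%C * cis t)))%R.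
Proof.
move=> a0 dF FB.
have dom r t : a < r < b -> a < cabs (r%:C%C * cis t) < b.
  by move=> /andP[ar rb]; rewrite cabs_polar ?ar //; apply: ltW; apply: le_lt_trans ar.
have dr r t : a < r < b -> is_cderive (F \o (fun s => s%:C%C * cis t)) r (F' (r%:C%C * cis t) * cis t).
  by move=> rab; apply: dF (is_cderive_radius t r) => //; exact: dom.
have dt r t : a < r < b ->
    is_cderive (F \o (fun s => r%:C%C * cis s)) t (F' (r%:C%C * cis t) * (Complex 0 1 * (r%:C%C * cis t))).
  by move=> rab; apply: dF (is_cderive_angle r t) => //; exact: dom.
apply: (@periodic_mean_constant R (fun r t => complex.Re (F (r%:C%C * cis t)))
  (fun r t => complex.Re (F' (r%:C%C * cis t) * cis t))
  (fun r t => r^-1 *: complex.Im (F (r%:C%C * cis t))) a b (2 * pi) B).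
- by rewrite mulr_gt0 // pi_gt0.
- by move=> r t rab; have [] := dr r t rab.
- move=> r t rab; have [_ H] := dt r t rab.
  have r0 : r != 0 by case/andP: rab => ar _; rewrite gt_eqF // (le_lt_trans a0).
  apply: (is_derive_eq (is_deriveZ r^-1 H)).
  by rewrite !(ReM, ImM) /GRing.scale /=; field.
- move=> r t rab; apply: le_trans (ler_Re_cabs _) _.
  by rewrite cabsM cabs_cis mulr1 FB // dom.
- by move=> r rab t; have [H _] := dt r t rab; exact: is_derive_continuous H.
- move=> r _; rewrite (_ : cis (2 * pi) = cis 0) //.
  by rewrite /cis mulr_natl cos2pi sin2pi cos0 sin0.
Qed.

(* Cauchy's formula for [M'(0)]: the mean of [Re (M z / z)] over [`|z| = r] does
   not depend on [r], and [r] times it has derivative [2 * pi * Re (M' 0)] at 0. *)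
Lemma circle_mean_div M M' B :
  (forall z, cabs z < 2 -> is_cdiff M z (M' z)) ->
  (forall z, cabs z < 2 -> cabs (M' z) <= B) -> M 0 = 0 ->
  (\int[@lebesgue_measure R]_(t in `[0%R, (2 * pi)%R]) complex.Re (M (cis t) / cis t))%R =
  2 * pi * complex.Re (M' 0).
Proof.
move=> dM MB M0.
have z2 : cabs (0 : R[i]) < 2 by rewrite cabs0 ltr0n.
have B0 : 0 <= B by apply: le_trans (MB 0 z2); exact: cabs_ge0.
have ML := is_cdiff_disc_bound dM MB M0.
pose A r : R := (\int[@lebesgue_measure R]_(t in `[0%R, (2 * pi)%R])
   complex.Re (M (r%:C%C * cis t) / (r%:C%C * cis t)))%R.
have Aconst r : 0 < r < 1 -> A r = A 1.
  move=> /andP[r0 r1].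
  (* The annulus of inner radius [r / 2] contains both circles and avoids the pole at 0; the bound
     comes from the product rule, with [4 * B] bounding [M]. *)
  have r20 : 0 < r / 2 by rewrite divr_gt0.
  apply: (@circle_mean_constant (fun z => M z * z^-1)
    (fun z => M z * (- z ^- 2 * 1) + M' z * z^-1) (r / 2) 2
    (4 * B * (r / 2) ^- 2 + B * (r / 2)^-1)); rewrite ?(ltW r20) ?ltr1n //.
  - move=> z /andP[rz zlt2]; have z0 : z != 0 by rewrite -cabs_gt0 (lt_trans r20).
    by apply: is_cdiffM; [exact: dM|exact: is_cdiff_comp (@is_cdiff_id _ z) (is_cdiffV z0)].
  - move=> z /andP[rz zlt2].
    have zV : cabs z^-1 <= (r / 2)^-1.
      by rewrite cabsV lef_pV2 ?posrE ?(lt_trans r20 rz) // ltW.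
    have zV2 : cabs (- z ^- 2 * 1) <= (r / 2) ^- 2.
      rewrite mulr1 cabsN -!exprVn !expr2 cabsM.
      by apply: ler_pM; rewrite ?cabs_ge0.
    apply: le_trans (ler_cabsD _ _) _; rewrite !(cabsM _ z^-1) cabsM.
    by apply: lerD; apply: ler_pM; rewrite ?cabs_ge0 ?ML ?MB.
  - by rewrite gtr_pMr // invf_lt1 // ltr1n.
(* For [r > 0] this is [r * A r], written without the division by [r] so that it can be
   differentiated at 0. *)
pose S r : R := (\int[@lebesgue_measure R]_(t in `[0%R, (2 * pi)%R])
   complex.Re (M (r%:C%C * cis t) / cis t))%R.
have dom r t : -1 < r < 1 -> cabs (r%:C%C * cis t) < 2.
  move=> r1; rewrite cabsM cabs_cis mulr1 cabs_real; apply: (@lt_trans _ _ 1); last by rewrite ltr1n.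
  by rewrite ltr_norml.
have d1 r t : -1 < r < 1 -> is_cderive (fun s => M (s%:C%C * cis t) / cis t) r (M' (r%:C%C * cis t)).
  move=> r1; have H := dM _ (dom r t r1) _ _ _ erefl (is_cderive_radius t r).
  apply: (is_cderive_eq (is_cderiveM H (is_cderive_cst (cis t)^-1 r))).
  by rewrite mulr0 add0r mulfK // cis_neq0.
have dS : is_derive (0 : R) 1 S (2 * pi * complex.Re (M' 0)).
  have := @is_derive_under_integral R (fun r t => complex.Re (M (r%:C%C * cis t) / cis t))
    (fun r t => complex.Re (M' (r%:C%C * cis t))) (-1) 1 (2 * pi) B.
  move=> /(_ _ _ _ 0) H.
  apply: (is_derive_eq (H _ _ _ _)).
  + by move=> r t r1; case: (d1 r t r1).
  + by move=> r t r1; apply: le_trans (ler_Re_cabs _) (MB _ (dom r t r1)).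
  + move=> r r1 t.
    have H1 := dM _ (dom r t r1) _ _ _ erefl (is_cderive_angle r t).
    have H2 := is_cdiff_comp (@is_cdiff_id _ (cis t)) (is_cdiffV (cis_neq0 t)).
    have H3 := H2 _ _ _ erefl (is_cderive_cis t).
    have [H4 _] := is_cderiveM H1 H3.
    exact: is_derive_continuous H4.
  + by rewrite ltrN10 ltr01.
  + under eq_Rintegral do rewrite mul0r.
    rewrite Rintegral_cst //= lebesgue_measure_itv /= lte_fin mulr_gt0 ?pi_gt0 //=.
    by rewrite subr0 mulrC.
have S0 : S 0 = 0.
  rewrite /S; under eq_Rintegral do rewrite mul0r M0 mul0r.
  by rewrite Rintegral_cst //= mul0r.
have SA r : 0 < r < 1 -> S r = r * A 1.
  move=> r01; rewrite -(Aconst r r01) /S /A -RintegralZl //; last first.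
    apply: integrable_continuous_segment => t.
    have /andP[r0 r1] := r01.
    have rn0 : r%:C%C * cis t != 0.
      by rewrite mulf_neq0 ?cis_neq0 // -cabs_gt0 cabs_real normr_gt0 gt_eqF.
    have rm : -1 < r < 1 by rewrite r1 (lt_trans _ r0) // ltrN10.
    have H1 := is_cdiff_comp (@is_cdiff_id _ (r%:C%C * cis t)) (is_cdiffV rn0).
    have H2 := is_cdiffM (dM _ (dom r t rm)) H1.
    have [H4 _] := H2 _ _ _ erefl (is_cderive_angle r t).
    exact: is_derive_continuous H4.
  apply: eq_Rintegral => t _.
  have r0 : r%:C%C != 0 :> R[i].
    by case/andP: r01 => r0 _; rewrite -cabs_gt0 cabs_real normr_gt0 gt_eqF.
  have -> : M (r%:C%C * cis t) / cis t = r%:C%C * (M (r%:C%C * cis t) / (r%:C%C * cis t)).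
    by field; rewrite r0 cis_neq0.
  by rewrite ReM /= mul0r subr0.
have -> : (\int[@lebesgue_measure R]_(t in `[0%R, (2 * pi)%R]) complex.Re (M (cis t) / cis t))%R = A 1.
  by apply: eq_Rintegral => t _; rewrite mul1r.
(* To the right of 0, [S] is linear with slope [A 1], so [A 1] must be its derivative at 0: for each
   [e] a single small [h > 0] compares the two up to [e]. *)
apply/eqP; rewrite -subr_eq0 -normr_le0; apply/ler_addgt0Pl => e e0; rewrite addr0.
have /is_derive_littleo /(_ e e0) [r r0 Hr] := dS.
pose h := Num.min (r / 2) (2^-1).
have h0 : 0 < h by rewrite lt_min divr_gt0 // invr_gt0 ltr0n.
have h1 : h < 1 by rewrite gt_min; apply/orP; right; rewrite invf_lt1 ?ltr1n.
have hr : h < r by rewrite gt_min; apply/orP; left; rewrite gtr_pMr // invf_lt1 ?ltr1n.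
have := Hr h; rewrite gtr0_norm // add0r S0 subr0 SA ?h0 // -mulrBr normrM gtr0_norm //.
by rewrite (mulrC e) ler_pM2l // => /(_ hr).
Qed.

(* On the unit circle the kernel [(1 + z)^2 / (2 z)] equals [1 + Re z >= 0]. *)
Lemma log_gradient_ge F F' B :
  (forall z, cabs z < 2 -> is_cdiff F z (F' z)) ->
  (forall z, cabs z < 2 -> 1 < cabs (F z)) ->
  (forall z, cabs z < 2 -> cabs (F' z) <= B) ->
  - (4 * ln (cabs (F 0))) <= complex.Re (F' 0 / F 0).
Proof.
move=> dF F1 FB.
have [L [L0 dL ReL]] := holomorphic_log dF F1 FB.
have z2 : cabs (0 : R[i]) < 2 by rewrite cabs0 ltr0n.
have B0 : 0 <= B by apply: le_trans (FB 0 z2); exact: cabs_ge0.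
have LB z : cabs z < 2 -> cabs (F' z / F z) <= B.
  move=> zlt2; rewrite cabsM cabsV ler_pdivrMr; last by apply: lt_trans (F1 z zlt2).
  by apply: le_trans (FB z zlt2) _; rewrite ler_peMr // ltW // F1.
have LL := is_cdiff_disc_bound dL LB L0.
(* After division by [z] this is the kernel above. As [L 0 = 0] and [K 0 = 1 / 2], the derivative of
   [L * K] at 0 is half of [F' 0 / F 0]. *)
pose K z : R[i] := (1 + z) * (1 + z) * (2^-1 : R)%:C%C.
pose K' z : R[i] := 1 + z.
have dK z : is_cdiff K z (K' z).
  have H := is_cdiffD (@is_cdiff_cst _ 1 z) (@is_cdiff_id _ z).
  apply: (is_cdiff_eq (is_cdiffM (is_cdiffM H H) (@is_cdiff_cst _ (2^-1 : R)%:C%C z))).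
  by apply: eq_Re_Im; rewrite /K' !(ReM, ImM, ReD, ImD) /=; field.
have K'B z : cabs z < 2 -> cabs (1 + z) <= 3.
  by move=> zlt2; apply: le_trans (ler_cabsD _ _) _; rewrite cabs1; lra.
have KB z : cabs z < 2 -> cabs (K z) <= 9.
  move=> zlt2; rewrite /K !cabsM cabs_real ger0_norm ?invr_ge0 ?ler0n //.
  have H := K'B z zlt2; have H0 := cabs_ge0 (1 + z).
  have H9 : cabs (1 + z) * cabs (1 + z) <= 3 * 3 by apply: ler_pM.
  have H1 : 0 <= cabs (1 + z) * cabs (1 + z) by apply: mulr_ge0.
  by lra.
pose M z := L z * K z.
pose M' z := L z * K' z + F' z / F z * K z.
have dM z : cabs z < 2 -> is_cdiff M z (M' z).
  by move=> zlt2; apply: is_cdiffM (dK z); exact: dL.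
have MB z : cabs z < 2 -> cabs (M' z) <= 4 * B * 3 + B * 9.
  move=> zlt2; apply: le_trans (ler_cabsD _ _) _; rewrite !(cabsM _ (K _)) cabsM.
  by apply: lerD; apply: ler_pM; rewrite ?cabs_ge0 ?LL ?K'B ?LB ?KB.
have M0 : M 0 = 0 by rewrite /M L0 mul0r.
have := circle_mean_div dM MB M0.
have -> : M' 0 = F' 0 / F 0 * (2^-1 : R)%:C%C.
  by rewrite /M' L0 mul0r add0r /K addr0 !mul1r.
rewrite ReM_real => mean.
have u0 : 0 <= ln (cabs (F 0)) by rewrite ln_ge0 // ltW // F1.
(* The real part of [L] is at least [- ln (cabs (F 0))] because [F] has modulus above 1, and the
   kernel [1 + cos t] lies between 0 and 2. With the half above, this gives the constant 4. *)
have lower t : - (2 * ln (cabs (F 0))) <= complex.Re (M (cis t) / cis t).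
  have t2 : cabs (cis t) < 2 by rewrite cabs_cis ltr1n.
  have -> : M (cis t) / cis t = L (cis t) * (1 + cos t)%:C%C.
    rewrite /M /K -!mulrA; congr (_ * _).
    apply: (mulIf (cis_neq0 t)); rewrite -!mulrA mulVf ?cis_neq0 // mulr1.
    have := cos2Dsin2 t; rewrite !expr2 => cs.
    by apply: eq_Re_Im; rewrite !(ReM, ImM, ReD, ImD) /=; [nra|field].
  rewrite ReM_real (ReL _ t2).
  have u1 : 0 <= ln (cabs (F (cis t))) by rewrite ln_ge0 // ltW // F1.
  by have := cos_le1 t; have := cos_geN1 t; nra.
have pi20 : 0 < 2 * pi :> R by rewrite mulr_gt0 ?pi_gt0.
have : 2 * pi * - (2 * ln (cabs (F 0))) <= 2 * pi * (complex.Re (F' 0 / F 0) * 2^-1).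
  rewrite -mean.
  have <- : (\int[@lebesgue_measure R]_(t in `[0%R, (2 * pi)%R]) (- (2 * ln (cabs (F 0)))))%R =
    2 * pi * - (2 * ln (cabs (F 0))).
    rewrite Rintegral_cst //= lebesgue_measure_itv /= lte_fin pi20 /=.
    by rewrite subr0 mulrC.
  apply: le_Rintegral => //.
  - by apply: (@integrable_continuous_segment R (fun=> _)) => t; exact: cvg_cst.
  - apply: integrable_continuous_segment => t.
    have t2 : cabs (cis t) < 2 by rewrite cabs_cis ltr1n.
    have H1 := is_cdiff_comp (@is_cdiff_id _ (cis t)) (is_cdiffV (cis_neq0 t)).
    have H3 := is_cdiffM (dM _ t2) H1.
    have [H2 _] := H3 _ _ _ erefl (is_cderive_cis t).
    exact: is_derive_continuous H2.
by rewrite ler_pM2l //; lra.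
Qed.

End HolomorphicLog.

(** * Restriction to complex lines *)

(** Dividing by [n + 1] instead of [n] covers dimension 0 and keeps the inequality strict. *)
Lemma sum_ord_div_lt (R : realFieldType) (n : nat) (e : R) : 0 < e ->
  \sum_(j < n) e / n.+1%:R < e.
Proof.
move=> e0; rewrite sumr_const card_ord -[ltLHS]mulr_natr -mulrA gtr_pMr //.
by rewrite mulrC ltr_pdivrMr ?ltr0n // mul1r ltr_nat.
Qed.

Section SumNorm.
Context {R : realType} {n : nat}.
Implicit Types (v w z : 'rV[R[i]^o]_n) (c : R[i]).

(* A real-valued norm inducing the topology: the norm of the normed module
   ['rV[R[i]^o]_n] takes its values in [R[i]]. *)
Definition snorm v : R := \sum_(j < n) cabs (v ord0 j).

Lemma snorm_ge0 v : 0 <= snorm v.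
Proof. by apply: sumr_ge0 => j _; exact: cabs_ge0. Qed.

Lemma snorm0 : snorm 0 = 0.
Proof. by apply: big1 => j _; rewrite mxE cabs0. Qed.

Lemma ler_snormD v w : snorm (v + w) <= snorm v + snorm w.
Proof.
by rewrite /snorm -big_split /=; apply: ler_sum => j _; rewrite mxE ler_cabsD.
Qed.

Lemma snormZ c v : snorm (c *: v) = cabs c * snorm v.
Proof. by rewrite /snorm mulr_sumr; apply: eq_bigr => j _; rewrite mxE cabsM. Qed.

Lemma snormN v : snorm (- v) = snorm v.
Proof. by apply: eq_bigr => j _; rewrite mxE cabsN. Qed.

Lemma snormB v w : snorm (v - w) = snorm (w - v).
Proof. by rewrite -snormN opprB. Qed.

Lemma ler_snorm_dist v w z : snorm (v - z) <= snorm (v - w) + snorm (w - z).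
Proof. by rewrite (_ : v - z = (v - w) + (w - z)) ?ler_snormD // addrA subrK. Qed.

Lemma ler_cabs_snorm v j : cabs (v ord0 j) <= snorm v.
Proof.
by rewrite /snorm (bigD1 j) //= lerDl; apply: sumr_ge0 => k _; exact: cabs_ge0.
Qed.

Lemma nbhs_snorm z (P : set 'rV[R[i]^o]_n) :
  nbhs z P <-> exists2 r : R, 0 < r & forall w, snorm (w - z) < r -> P w.
Proof.
split.
  move=> /nbhs_ballP[e /= e0 eP].
  (* Positive elements of [R[i]] are real, so the radius [e] equals its real part. *)
  have e0' : 0 < complex.Re e by move: e0; rewrite ltcE /= => /andP[].
  exists (complex.Re e) => // w wz; apply: eP; split => // i j.
  rewrite ord1 -ball_normE /= -cabsE.
  have -> : e = (complex.Re e)%:C%C.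
    by move: e0; rewrite ltcE /= => /andP[/eqP]; case: (e) => a b /= ->.
  rewrite ltcR cabsB; apply: le_lt_trans wz.
  by have := ler_cabs_snorm (w - z) j; rewrite !mxE.
move=> [r r0 rP]; apply/nbhs_ballP.
have rn0 : 0 < r / n.+1%:R by rewrite divr_gt0 // ltr0n.
exists (r / n.+1%:R)%:C%C; first by rewrite /= ltcR.
move=> w [_ wz]; apply: rP.
apply: le_lt_trans (sum_ord_div_lt n r0).
apply: ler_sum => j _; rewrite !mxE; apply: ltW.
by have := wz ord0 j; rewrite -ball_normE /= -cabsE ltcR cabsB.
Qed.

End SumNorm.

Section DirectionalDerivative.
Context {R : realType} {n : nat}.
Implicit Types (f : 'rV[R[i]^o]_n -> R[i]^o) (z v w : 'rV[R[i]^o]_n) (c : R[i]).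

Lemma row_sum_basis_vec v : v = \sum_(j < n) v ord0 j *: basis_vec R j.
Proof.
apply/rowP => k; rewrite summxE (bigD1 k) //= big1 => [|j jk]; rewrite !mxE.
  by rewrite eqxx addr0 [LHS](esym (mulr1 _)).
by rewrite eq_sym (negbTE jk) /GRing.scale /= mulr0.
Qed.

(** The differential is linear over [R[i]], so it can be expanded on the basis vectors with complex
    coordinates. *)
Lemma DfvE f z v : differentiable f z -> Dfv f z v = 'D_v f z.
Proof.
move=> df; rewrite [in RHS]deriveE // {2}(row_sum_basis_vec v) linear_sum.
by apply: eq_bigr => j _; rewrite linearZ /= /partial deriveE // mulrC.
Qed.

Lemma DfvZ f z v c : Dfv f z (c *: v) = c * Dfv f z v.
Proof. by rewrite /Dfv mulr_sumr; apply: eq_bigr => j _; rewrite mxE mulrCA. Qed.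

(** The directional derivative is a limit over complex increments, so the restriction to a complex
    line is complex differentiable; this expansion yields both the rule along curves and
    continuity. *)
Lemma slice_littleo f w v c : differentiable f (w + c *: v) ->
  forall e, 0 < e -> exists2 r, 0 < r & forall h, cabs h < r ->
    cabs (f (w + (c + h) *: v) - f (w + c *: v) - h * Dfv f (w + c *: v) v) <= e * cabs h.
Proof.
move=> df e e0; rewrite (DfvE v df); set z := w + c *: v.
have /cvgrPdist_le /(_ e%:C%C) : (h^-1 *: (f (h *: v + z) - f z)) @[h --> (0 : R[i]^o)^'] --> 'D_v f z.
  exact: diff_derivable.
rewrite ltcR => /(_ e0) /nbhs_ballP[d /= d0 dP].
have dE : d = (complex.Re d)%:C%C.
  by move: d0; rewrite ltcE /= => /andP[/eqP]; case: (d) => a b /= ->.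
exists (complex.Re d) => [|h hd].
  by move: d0; rewrite ltcE /= => /andP[].
have [->|h0] := eqVneq h 0; first by rewrite addr0 subrr mul0r subrr cabs0 mulr0.
have : ball (0 : R[i]^o) d h by rewrite -ball_normE /= sub0r normrN -cabsE dE ltcR.
move=> /dP /(_ h0); rewrite -cabsE lecR cabsB => H.
have -> : w + (c + h) *: v = h *: v + z by rewrite /z scalerDl addrA addrC.
rewrite (_ : _ - h * _ = (h^-1 * (f (h *: v + z) - f z) - 'D_v f z) * h); last first.
  by rewrite mulrBl mulrAC mulVf // mul1r (mulrC h).
by rewrite cabsM ler_wpM2r ?cabs_ge0.
Qed.

Lemma slice_is_cdiff f w v c : differentiable f (w + c *: v) ->
  is_cdiff (fun h => f (w + h *: v)) c (Dfv f (w + c *: v) v).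
Proof. by move=> df; apply: is_cdiff_littleo; exact: slice_littleo. Qed.

Lemma slice_continuous f w v c : differentiable f (w + c *: v) ->
  forall e, 0 < e -> exists2 r, 0 < r & forall h, cabs h < r ->
    cabs (f (w + (c + h) *: v) - f (w + c *: v)) < e.
Proof.
move=> df e e0; have [r r0 Hr] := slice_littleo df ltr01.
set d := Dfv _ _ _ in Hr.
pose A := 1 + cabs d; have A0 : 0 < A by rewrite ltr_wpDr ?cabs_ge0.
exists (Num.min r (e / A)) => [|h]; first by rewrite lt_min r0 divr_gt0.
rewrite lt_min => /andP[/Hr]; rewrite mul1r => H hA.
set k := (X in cabs X < e); rewrite -/k in H.
rewrite -[k](subrK (h * d)).
apply: le_lt_trans (ler_cabsD _ _) _.
apply: (@le_lt_trans _ _ (A * cabs h)).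
  by rewrite /A mulrDl mul1r cabsM (mulrC (cabs d)) lerD2r.
by rewrite mulrC -ltr_pdivlMr.
Qed.

(** The supremum over unit vectors is applied to [v] divided by its Euclidean norm [N], which is at
    most [snorm v]. *)
Lemma Dfv_le (alpha M : R) f z v : F_alpha alpha f z <= M ->
  cabs (Dfv f z v) <= M * snorm v * (1 + cabs (f z) `^ alpha).
Proof.
move=> FM; have den0 : 0 < 1 + cabs (f z) `^ alpha by rewrite ltr_wpDr ?powR_ge0.
pose N := Num.sqrt (\sum_(j < n) cabs (v ord0 j) ^+ 2).
have sum0 : 0 <= \sum_(j < n) cabs (v ord0 j) ^+ 2 by apply: sumr_ge0 => j _; exact: sqr_ge0.
have N0 : 0 <= N by exact: sqrtr_ge0.
have NS : N <= snorm v.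
  rewrite -(@ler_pXn2r _ 2) ?nnegrE ?snorm_ge0 // sqr_sqrtr // expr2 /snorm mulr_suml.
  by apply: ler_sum => j _; rewrite expr2 ler_wpM2l ?cabs_ge0 // ler_cabs_snorm.
have jN (u : 'rV[R[i]^o]_n) j : cabs (u ord0 j) <= Num.sqrt (\sum_(j < n) cabs (u ord0 j) ^+ 2).
  rewrite -[leLHS]ger0_norm ?cabs_ge0 // -sqrtr_sqr ler_sqrt; last first.
    by apply: sumr_ge0 => k _; exact: sqr_ge0.
  by rewrite (bigD1 j) //= lerDl; apply: sumr_ge0 => k _; exact: sqr_ge0.
have [N_eq0|Nn0] := eqVneq N 0.
  have v0 j : v ord0 j = 0.
    by apply/eqP; rewrite -cabs_eq0 eq_le cabs_ge0 andbT -N_eq0; exact: jN.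
  rewrite /Dfv big1 ?cabs0 => [|j _]; last by rewrite v0 mulr0.
  by rewrite /snorm big1 ?mulr0 ?mul0r // => j _; rewrite v0 cabs0.
have N_gt0 : 0 < N by rewrite lt0r Nn0.
pose u : 'rV[R[i]^o]_n := (N^-1)%:C%C *: v.
have unit_u : unit_vec u.
  rewrite /unit_vec /u.
  under eq_bigr do rewrite mxE cabsM cabs_real ger0_norm ?invr_ge0 // exprMn.
  by rewrite -mulr_sumr sqrtrM ?sqr_ge0 // sqrtr_sqr ger0_norm ?invr_ge0 // mulVf.
(* [sup] is known to dominate its set only if the set is bounded above; here this holds because the
   coordinates of a unit vector have modulus at most 1. *)
have ub : has_ubound [set cabs (Dfv f z v) / (1 + cabs (f z) `^ alpha) | v in unit_vec (n:=n) (R:=R)].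
  exists ((\sum_(j < n) cabs (partial f j z)) / (1 + cabs (f z) `^ alpha)) => _ [w w1 <-].
  rewrite ler_pM2r ?invr_gt0 //; apply: le_trans (ler_cabs_sum _) _.
  apply: ler_sum => j _; rewrite cabsM ler_piMr ?cabs_ge0 //.
  by apply: le_trans (jN w j) _; rewrite w1.
have : cabs (Dfv f z u) / (1 + cabs (f z) `^ alpha) <= M.
  by apply: le_trans FM; apply: ub_le_sup => //; exists u.
rewrite DfvZ cabsM cabs_real ger0_norm ?invr_ge0 // => H.
have M0 : 0 <= M.
  by apply: le_trans H; rewrite mulr_ge0 ?invr_ge0 ?(ltW den0) // mulr_ge0 ?invr_ge0 ?cabs_ge0.
move: H; rewrite ler_pdivrMr // ler_pdivrMl // => /le_trans; apply.
by rewrite mulrA ler_pM2r // mulrC ler_wpM2l.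
Qed.

End DirectionalDerivative.

(** * Limits along ultrafilters *)

Section UltraLimits.
Context {R : realType} {U : set_system nat} {UU : UltraFilter U}.

(** Compactness of [[-A, A]] gives a cluster point, and an ultrafilter converges to each of its
    cluster points: a set outside [U] would have its complement in [U]. *)
Lemma ultra_limit_real (u : nat -> R) (A : R) : U [set k | `|u k| <= A] ->
  exists l, forall e, 0 < e -> U [set k | `|u k - l| < e].
Proof.
move=> uA.
have H : U [set k | u k \in `[(- A), A]].
  by apply: filterS uA => k; rewrite /= in_itv /= -ler_norml.
have [l [_ cl]] := @segment_compact R (- A) A (u @ U) _ H.
exists l => e e0; have [//|/= Uc] := in_ultra_setVsetC [set k | `|u k - l| < e] UU.
have UA : (u @ U) [set x | ~ (`|x - l| < e)] by exact: Uc.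
have [x [/= nx]] := cl _ _ UA (nbhsx_ballx l e e0).
by rewrite -ball_normE /= distrC.
Qed.

Lemma ultra_limit_complex (u : nat -> R[i]) (A : R) : U [set k | cabs (u k) <= A] ->
  exists l, forall e, 0 < e -> U [set k | cabs (u k - l) < e].
Proof.
move=> uA.
have [a Ha] : exists l, forall e, 0 < e -> U [set k | `|complex.Re (u k) - l| < e].
  apply: (@ultra_limit_real _ A); apply: filterS uA => k /=.
  by apply: le_trans; exact: ler_Re_cabs.
have [b Hb] : exists l, forall e, 0 < e -> U [set k | `|complex.Im (u k) - l| < e].
  apply: (@ultra_limit_real _ A); apply: filterS uA => k /=.
  by apply: le_trans; exact: ler_Im_cabs.
exists (Complex a b) => e e0; have e20 : 0 < e / 2 by rewrite divr_gt0.
apply: filterS (filterI (Ha _ e20) (Hb _ e20)) => k [/= ka kb].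
apply: le_lt_trans (cabs_le_Re_Im _) _; rewrite ReD ImD ReN ImN /= [ltRHS]splitr.
exact: ltrD.
Qed.

Lemma ultra_limit_row (n : nat) (u : nat -> 'rV[R[i]^o]_n) (A : R) :
  U [set k | snorm (u k) <= A] ->
  exists l, forall e, 0 < e -> U [set k | snorm (u k - l) < e].
Proof.
move=> uA.
have /choice [l Hl] : forall j : 'I_n, exists l, forall e, 0 < e ->
    U [set k | cabs (u k ord0 j - l) < e].
  move=> j; apply: (@ultra_limit_complex _ A); apply: filterS uA => k /=.
  by apply: le_trans; exact: ler_cabs_snorm.
exists (\row_j l j) => e e0.
have en0 : 0 < e / n.+1%:R by rewrite divr_gt0 // ltr0n.
have : U [set k | forall j, cabs (u k ord0 j - l j) < e / n.+1%:R].
  by apply: filter_forall => j; exact: Hl.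
apply: filterS => k /= H.
apply: le_lt_trans (sum_ord_div_lt n e0).
by apply: ler_sum => j _; rewrite !mxE ltW.
Qed.

End UltraLimits.

(** If [F] were unbounded, points where its modulus exceeds [k] would have an ultralimit in the
    closed disc, and continuity there would bound [F] at arbitrarily late ones. *)
Lemma disc_bounded (R : realType) (F : R[i] -> R[i]) (r : R) :
  (forall z, cabs z <= r -> forall e, 0 < e -> exists2 d, 0 < d &
     forall h, cabs h < d -> cabs (F (z + h) - F z) < e) ->
  exists C, forall z, cabs z <= r -> cabs (F z) <= C.
Proof.
move=> cF; apply: contrapT => /forallNP unb.
have /choice[u Hu] : forall k : nat, exists z, cabs z <= r /\ k%:R < cabs (F z).
  move=> k; have /existsNP[z /not_implyP[zr /negP]] := unb k%:R.
  by rewrite -ltNge => zk; exists z.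
have [U [UU oU]] := ultraFilterLemma (eventually_filter : ProperFilter \oo).
have UP : ProperFilter U by exact: ultra_proper.
have [z Hz] : exists l, forall e, 0 < e -> U [set k | cabs (u k - l) < e].
  by apply: (@ultra_limit_complex _ _ UU u r); apply: nearW => k; case: (Hu k).
have zr : cabs z <= r.
  apply/ler_addgt0Pl => e e0; have [k /= uz] := filter_ex (Hz e e0).
  have [ukr _] := Hu k.
  rewrite -[z](subrK (u k)); apply: le_trans (ler_cabsD _ _) _.
  by rewrite cabsB lerD // ltW.
have [d d0 Hd] := cF z zr 1 ltr01.
have [k [/= kz kA]] := filter_ex (filterI (Hz d d0)
  (oU _ (nbhs_infty_gtr (cabs (F z) + 1)))).
have [_ kF] := Hu k; have := Hd _ kz; rewrite (addrC z) subrK => FF.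
have : cabs (F (u k)) <= cabs (F (u k) - F z) + cabs (F z).
  by rewrite -{1}[F (u k)](subrK (F z)) ler_cabsD.
by lra.
Qed.

(** The filter need not be closed under countable intersections, but choosing [phi m] beyond
    [phi (m - 1)] and in all of [S 0], ..., [S m] gives a sequence that is eventually in every
    [S i]. *)
Lemma pseudo_intersection (U : set_system nat) (S : nat -> set nat) :
  ProperFilter U -> \oo `<=` U -> (forall i, U (S i)) ->
  exists phi : nat -> nat, (forall m, (phi m < phi m.+1)%N) /\
    forall i, \forall m \near \oo, S i (phi m).
Proof.
move=> UP oU US.
have /choice[c Hc] : forall Nm : nat * nat,
    exists k, (Nm.1 < k)%N /\ forall i, (i <= Nm.2)%N -> S i k.
  move=> [N m] /=.
  have H1 : U [set k | forall i : 'I_m.+1, S i k] by apply: filter_forall => i; exact: US.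
  have H2 : U [set k | (N < k)%N] by apply: oU; exact: nbhs_infty_gt.
  have [k [/= k1 k2]] := filter_ex (filterI H1 H2).
  by exists k; split => // i im; exact: (k1 (Ordinal (im : (i < m.+1)%N))).
pose phi := fix phi m := if m is m'.+1 then c (phi m', m) else c (0, 0)%N.
exists phi; split => [m|i]; first by have [] := Hc (phi m, m.+1).
exists i => // -[|m] /= im; first by have [_] := Hc (0, 0)%N; apply.
by have [_] := Hc (phi m, m.+1); apply.
Qed.

Lemma dense_row_sequence (R : realType) (n : nat) :
  exists q : nat -> 'rV[R[i]^o]_n, forall z e, 0 < e -> exists i, snorm (z - q i) < e.
Proof.
pose v (p : {ffun 'I_n -> rat * rat}) : 'rV[R[i]^o]_n :=
  \row_j (Complex (ratr (p j).1) (ratr (p j).2)).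
(* Vectors with Gaussian rational entries, enumerated by [unpickle]; indices that code nothing give
   the zero vector. *)
exists (fun i => odflt 0 (omap v (unpickle i))) => z e e0.
pose d := e / n.+1%:R / 2.
have d0 : 0 < d by rewrite !divr_gt0 // ltr0n.
have rat_approx (x : R) : exists a : rat, `|x - ratr a| < d.
  have [a] := @rat_in_itvoo R (x - d) (x + d) ltac:(by lra).
  rewrite in_itv /= => /andP[a1 a2]; exists a; rewrite ltr_norml.
  by apply/andP; split; lra.
have /choice[p Hp] : forall j : 'I_n, exists ab : rat * rat,
    `|complex.Re (z ord0 j) - ratr ab.1| < d /\ `|complex.Im (z ord0 j) - ratr ab.2| < d.
  move=> j; have [a Ha] := rat_approx (complex.Re (z ord0 j)).
  by have [b Hb] := rat_approx (complex.Im (z ord0 j)); exists (a, b).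
exists (pickle [ffun j => p j]); rewrite pickleK /=.
apply: le_lt_trans (sum_ord_div_lt n e0).
apply: ler_sum => j _; rewrite !mxE ffunE.
apply: le_trans (cabs_le_Re_Im _) _; rewrite ReD ImD ReN ImN /=.
have [/ltW H1 /ltW H2] := Hp j.
by rewrite [leRHS]splitr; exact: lerD.
Qed.

(* Countably many balls with centres in a dense sequence suffice to localize, so
   locally uniform membership in [U] passes to a single subsequence. *)
Lemma ultra_subsequence (R : realType) (n : nat) (D : set 'rV[R[i]^o]_n)
  (U : set_system nat) (P : nat -> nat -> 'rV[R[i]^o]_n -> Prop) :
  ProperFilter U -> \oo `<=` U ->
  (forall z, D z -> exists2 r, 0 < r &
     forall j, U [set k | forall w, snorm (w - z) < r -> P j k w]) ->
  exists phi : nat -> nat, (forall m, (phi m < phi m.+1)%N) /\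
    forall K, compact K -> K `<=` D -> forall j,
      \forall m \near \oo, forall w, K w -> P j (phi m) w.
Proof.
move=> UP oU HP.
have [q Hq] := dense_row_sequence R n.
pose ball_ i l w := snorm (w - q i) < l.+1%:R^-1.
pose good i l := forall j, U [set k | forall w, ball_ i l w -> P j k w].
(* The condition is imposed only for good balls, so every [S a] lies in [U], whichever triple the
   index codes. *)
pose S (a : nat) : set nat := if unpickle a is Some (i, l, j) then
  [set k | good i l -> forall w, ball_ i l w -> P j k w] else setT.
have US a : U (S a).
  rewrite /S; case: unpickle => [[[i l] j]|]; last exact: filterT.
  have [g|ng] := pselect (good i l).
    by apply: filterS (g j) => k /= + _.
  by apply: filterS filterT => k _ /ng.
have [phi [phiS Hphi]] := pseudo_intersection UP oU US.
exists phi; split => // K /compact_near_coveringP cK KD j.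
apply: (cK nat \oo (fun m w => P j (phi m) w)) => z /KD /HP[r r0 Hr].
(* A ball of radius less than [r / 2] whose centre is within that radius of [z] contains [z] and
   lies in the ball of radius [r] about [z], hence is good. *)
have [l lr] : exists l : nat, l.+1%:R^-1 < r / 2.
  exists (Num.truncn (r / 2)^-1).
  rewrite invf_plt ?posrE ?ltr0n ?divr_gt0 //.
  by have /andP[] := truncn_itv (ltW (ltac:(by rewrite invr_gt0 divr_gt0) : 0 < (r / 2)^-1)).
have [i zi] := Hq z l.+1%:R^-1 ltac:(by rewrite invr_gt0 ltr0n).
have g : good i l.
  move=> j'; apply: filterS (Hr j') => k /= H w wi; apply: H.
  apply: le_lt_trans (ler_snorm_dist _ (q i) _) _.
  rewrite [ltRHS]splitr; apply: ltrD; first exact: lt_trans lr.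
  by rewrite snormB; exact: lt_trans lr.
have := Hphi (pickle (i, l, j)); rewrite /S pickleK => Hm.
have near_z : \forall w \near z, ball_ i l w.
  apply/nbhs_snorm; exists (l.+1%:R^-1 - snorm (z - q i)); first by rewrite subr_gt0.
  move=> w wz; rewrite /ball_; apply: le_lt_trans (ler_snorm_dist _ z _) _.
  by rewrite -ltrBrDr.
exists ([set w | ball_ i l w], [set m | good i l -> forall w, ball_ i l w -> P j (phi m) w]) => //.
by move=> [w m] [/= wi mP]; exact: mP.
Qed.

(** * Harnack's inequality *)

Section Harnack.
Context {R : realType}.

(* The first time [|g|] reaches 2 comes too late: until then [g] is Lipschitz
   with constant less than 1. *)
Lemma cabs_lt2_of_growth (g g' : R -> R[i]) (alpha m : R) :
  0 <= alpha -> 2 * m * (1 + 2 `^ alpha) < 1 -> 0 <= m ->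
  (forall t, 0 <= t <= 1 -> is_cderive g t (g' t)) ->
  (forall t, 0 <= t <= 1 -> cabs (g' t) <= m * (1 + cabs (g t) `^ alpha)) ->
  cabs (g 0) <= 1 -> cabs (g 1) < 2.
Proof.
move=> alpha0 m1 m0 dg g'B g0; rewrite ltNge; apply/negP => g1.
pose S := [set t : R | 0 <= t <= 1 /\ 2 <= cabs (g t)].
have S1 : S 1 by split; rewrite // ler01 lexx.
have lbS : lbound S 0 by move=> t [/andP[]].
have iS : has_inf S by split; [exists 1 | exists 0].
pose s := inf S.
have s0 : 0 <= s by apply: lb_le_inf => //; exists 1.
have s1 : s <= 1 by apply: ge_inf => //; exists 0.
have s01 : 0 <= s <= 1 by rewrite s0.
have below t : 0 <= t < s -> cabs (g t) < 2.
  move=> /andP[t0 ts]; rewrite ltNge; apply/negP => gt.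
  have : S t by split; rewrite // t0 (le_trans (ltW ts)).
  by move=> /(ge_inf (ex_intro _ 0 lbS)); rewrite leNgt ts.
(* The infimum is attained: were the modulus below 2 at [s], the expansion at [s] would keep it
   below 2 for a short time after [s]. *)
have gs : 2 <= cabs (g s).
  rewrite leNgt; apply/negP => gs2.
  pose A := 1 + cabs (g' s); have A0 : 0 < A by rewrite ltr_wpDr ?cabs_ge0.
  have /is_cderive_littleo /(_ 1 ltr01)[r r0 Hr] := dg s s01.
  pose d := Num.min r ((2 - cabs (g s)) / A).
  have d0 : 0 < d by rewrite lt_min r0 divr_gt0 ?subr_gt0.
  have [t [t01 gt2] tsd] := inf_adherent d0 iS.
  have st : s <= t by apply: ge_inf; [exists 0 | split].
  have : `|t - s| < d by rewrite ger0_norm ?subr_ge0 // ltrBlDl.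
  rewrite lt_min => /andP[/Hr]; rewrite (addrC s) subrK mul1r => H hA.
  have : cabs (g t) <= cabs (g t - g s - (t - s)%:C%C * g' s) + (cabs ((t - s)%:C%C * g' s) + cabs (g s)).
    rewrite -{1}[g t](subrK (g s)) -{1}[g t - g s](subrK ((t - s)%:C%C * g' s)) -addrA.
    by apply: le_trans (ler_cabsD _ _) _; rewrite lerD2l ler_cabsD.
  rewrite cabsM cabs_real; move: hA; rewrite ltr_pdivlMr // /A mulrDr mulr1.
  by lra.
have dsg t : 0 <= t <= 1 -> is_cderive (fun t => g (s * t)) t (s%:C%C * g' (s * t)).
  move=> /andP[t0 t1]; have st01 : 0 <= s * t <= 1.
    by rewrite mulr_ge0 // mulr_ile1.
  have [H1 H2] := dg _ st01.
  have ds : is_derive t 1 (fun t : R => s * t) s.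
    by apply: (is_derive_eq (is_deriveZ s (is_derive_id t 1))); rewrite /GRing.scale /= mulr1.
  split.
    apply: (is_derive_eq (is_derive1_comp H1 ds)).
    by rewrite ReM /= mul0r subr0 mulrC.
  apply: (is_derive_eq (is_derive1_comp H2 ds)).
  by rewrite ImM /= mul0r addr0 mulrC.
have dB t : 0 < t < 1 -> cabs (s%:C%C * g' (s * t)) <= m * (1 + 2 `^ alpha).
  move=> /andP[t0 t1]; have st01 : 0 <= s * t <= 1.
    by rewrite mulr_ge0 ?(ltW t0) // mulr_ile1 // ltW.
  rewrite cabsM cabs_real ger0_norm //.
  apply: (@le_trans _ _ (1 * (m * (1 + cabs (g (s * t)) `^ alpha)))).
    by apply: ler_pM => //; rewrite ?cabs_ge0 // g'B.
  rewrite mul1r ler_wpM2l // lerD2l ge0_ler_powR ?nnegrE ?cabs_ge0 //.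
  (* For [s = 0] there is no earlier time, and the bound at time 0 is used instead. *)
  have [s_eq0|sn0] := eqVneq s 0.
    by rewrite s_eq0 mul0r (le_trans g0) // ler1n.
  by apply/ltW/below; rewrite mulr_ge0 ?(ltW t0) // gtr_pMr // lt0r sn0.
have HR := @MVT_segment01 _ (fun t => complex.Re (g (s * t)))
  (fun t => complex.Re (s%:C%C * g' (s * t))) (m * (1 + 2 `^ alpha))
  (fun t t01 => proj1 (dsg t t01))
  (fun t t01 => le_trans (ler_Re_cabs _) (dB t t01)).
have HI := @MVT_segment01 _ (fun t => complex.Im (g (s * t)))
  (fun t => complex.Im (s%:C%C * g' (s * t))) (m * (1 + 2 `^ alpha))
  (fun t t01 => proj2 (dsg t t01))
  (fun t t01 => le_trans (ler_Im_cabs _) (dB t t01)).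
move: HR HI; rewrite mulr1 mulr0 => HR HI.
have : cabs (g s - g 0) < 1.
  apply: le_lt_trans (cabs_le_Re_Im _) _; rewrite ReD ImD ReN ImN.
  by apply: le_lt_trans (lerD HR HI) _; lra.
have : cabs (g s) <= cabs (g s - g 0) + cabs (g 0).
  by rewrite -{1}[g s](subrK (g 0)) ler_cabsD.
by lra.
Qed.

(** Computed from half the logarithm of the squared modulus, so no branch of the argument is
    needed. *)
Lemma is_derive_ln_cabs (g : R -> R[i]) t d : g t != 0 -> is_cderive g t d ->
  is_derive t 1 (fun s => ln (cabs (g s))) (complex.Re (d / g t)).
Proof.
move=> g0 [dR dI].
have n0 : 0 < complex.Re (g t) ^+ 2 + complex.Im (g t) ^+ 2.
  by rewrite -sqr_cabs exprn_gt0 // cabs_gt0.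
have dn := is_deriveD (is_deriveM dR dR) (is_deriveM dI dI).
have n0' : 0 < ((fun s => complex.Re (g s)) * (fun s => complex.Re (g s)) +
  (fun s => complex.Im (g s)) * (fun s => complex.Im (g s))) t.
  by rewrite !fctE -!expr2.
have -> : (fun s => ln (cabs (g s))) = (fun s => 2^-1 *: ln ((complex.Re (g s) * complex.Re (g s) +
    complex.Im (g s) * complex.Im (g s)))).
  apply/funext => s; rewrite /GRing.scale /= -!expr2 -sqr_cabs.
  (* The two functions agree also at zeros of [g], since [ln] is 0 at 0. *)
  have [->|gs] := eqVneq (g s) 0; first by rewrite cabs0 expr0n ln0 // mulr0.
  by rewrite lnXn ?cabs_gt0 // mulr2n; field.
apply: (is_derive_eq (is_deriveZ 2^-1 (is_derive1_comp (is_derive1_ln n0') dn))).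
rewrite !(ReM, ReV, ImV) /GRing.scale /= !fctE.
by field; rewrite gt_eqF.
Qed.

Context {n : nat}.
Implicit Types (f : 'rV[R[i]^o]_n -> R[i]^o) (v w : 'rV[R[i]^o]_n).

Lemma segment_lipschitz f w v C :
  (forall t : R, 0 <= t <= 1 -> differentiable f (w + t%:C%C *: v)) ->
  (forall t : R, 0 <= t <= 1 -> cabs (Dfv f (w + t%:C%C *: v) v) <= C) ->
  cabs (f (w + v) - f w) <= 2 * C.
Proof.
move=> df fC.
have E (t : R) : 0 + t%:C%C * (1 : R[i]) = t%:C%C by rewrite mulr1 add0r.
have := @is_cdiff_lipschitz R (fun h => f (w + h *: v)) (fun h => Dfv f (w + h *: v) v) 0 1 C.
rewrite subr0 cabs1 scale0r addr0 scale1r mulr1; apply => t t01; rewrite E.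
  by apply: slice_is_cdiff; exact: df.
exact: fC.
Qed.

(** Along the segment, [k t = ln (cabs (f (w + t v)))] satisfies [k' >= - 4 k] by the gradient
    estimate on the disc of radius 2 about [t], so [k t * expR (4 * t)] is nondecreasing. Radius 3
    covers these discs for all [t] in [[0, 1]]. [M] and [alpha] only ensure that derivatives are
    bounded, so the constant is universal. *)
Lemma segment_harnack f w v (M alpha : R) :
  (forall h, cabs h <= 3 -> differentiable f (w + h *: v)) ->
  (forall h, cabs h <= 3 -> 1 < cabs (f (w + h *: v))) ->
  (forall h, cabs h <= 3 ->
     cabs (Dfv f (w + h *: v) v) <= M * (1 + cabs (f (w + h *: v)) `^ alpha)) ->
  0 <= M -> 0 <= alpha ->
  ln (cabs (f w)) <= expR 4 * ln (cabs (f (w + v))).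
Proof.
move=> df f1 fM M0 alpha0.
have [C HC] : exists C, forall h, cabs h <= 3 -> cabs (f (w + h *: v)) <= C.
  apply: disc_bounded => h h3 e e0.
  exact: (slice_continuous (df h h3) e0).
pose k (t : R) := ln (cabs (f (w + t%:C%C *: v))).
pose k' (t : R) := complex.Re (Dfv f (w + t%:C%C *: v) v / f (w + t%:C%C *: v)).
have t3 (t : R) : 0 <= t <= 1 -> cabs t%:C%C <= 3.
  by move=> /andP[t0 t1]; rewrite cabs_real ger0_norm //; lra.
have dk (t : R) : 0 <= t <= 1 -> is_derive t 1 k (k' t).
  move=> t01.
  have := slice_is_cdiff (df _ (t3 t t01)) (t := t) (g := fun s => s%:C%C) (d := 1) erefl.
  move=> H; apply: (@is_derive_ln_cabs (fun s => f (w + s%:C%C *: v))).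
    by rewrite -cabs_gt0; apply: lt_trans (f1 _ (t3 t t01)).
  rewrite -[Dfv _ _ _]mulr1; apply: H.
  by split; [exact: is_derive_id | exact: is_derive_cst].
have k'4 (t : R) : 0 <= t <= 1 -> - (4 * k t) <= k' t.
  move=> t01.
  have sum3 (z : R[i]) : cabs z < 2 -> cabs (t%:C%C + z) <= 3.
    move=> z2; apply: le_trans (ler_cabsD _ _) _.
    by move: t01 => /andP[t0 t1]; rewrite cabs_real ger0_norm //; lra.
  have H := @log_gradient_ge R (fun z => f (w + (t%:C%C + z) *: v))
    (fun z => Dfv f (w + (t%:C%C + z) *: v) v) (M * (1 + C `^ alpha)).
  move: H; rewrite addr0; apply.
  - move=> z /sum3 z3.
    have H1 := is_cdiffD (@is_cdiff_cst _ t%:C%C z) (@is_cdiff_id _ z).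
    have H2 := is_cdiff_comp H1 (slice_is_cdiff (df _ z3)).
    by rewrite add0r mulr1 in H2.
  - by move=> z /sum3 z3; exact: f1.
  - move=> z /sum3 z3; apply: le_trans (fM _ z3) _.
    rewrite ler_wpM2l // lerD2l ge0_ler_powR ?nnegrE ?cabs_ge0 //; last exact: HC.
    by apply: le_trans (HC _ z3); exact: cabs_ge0.
pose K (t : R) := k t * expR (4 * t).
have dK (t : R) : 0 <= t <= 1 -> is_derive t 1 K (expR (4 * t) * (k' t + 4 * k t)).
  move=> t01.
  have d4 : is_derive t 1 (fun t : R => 4 * t) 4.
    by apply: (is_derive_eq (is_deriveZ (4 : R) (is_derive_id t 1))); rewrite /GRing.scale /= mulr1.
  have dE := is_derive1_comp (is_derive_expR (4 * t)) d4.
  apply: (is_derive_eq (is_deriveM (dk t t01) dE)).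
  by rewrite /GRing.scale /=; ring.
have [t||t t01 KE] := @MVT_segment R K (fun t => expR (4 * t) * (k' t + 4 * k t)) 0 1 ler01.
- by rewrite in_itv /= => /andP[t0 t1]; apply: dK; rewrite !ltW.
- apply/continuous_in_subspaceT => t; rewrite inE /= in_itv /= => t01.
  exact: is_derive_continuous (dK t t01).
have : 0 <= K 1 - K 0.
  rewrite KE subr0 mulr1 mulr_ge0 ?expR_ge0 //.
  by move: t01; rewrite in_itv /= => /k'4; lra.
have K0 : K 0 = ln (cabs (f w)).
  by rewrite /K /k (mulr0 4) expR0 mulr1 scale0r addr0.
have K1 : K 1 = expR 4 * ln (cabs (f (w + v))).
  by rewrite /K /k (mulr1 4) scale1r mulrC.
by rewrite K0 K1 subr_ge0.
Qed.

End Harnack.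

(** * Local bounds and normality *)

Section NormalFamily.
Context {R : realType} {n : nat}.
Implicit Types (f : 'rV[R[i]^o]_n -> R[i]^o) (z v w : 'rV[R[i]^o]_n).

Lemma snorm_convex z w v (r t : R) : 0 <= t <= 1 ->
  snorm (w - z) < r -> snorm (w + v - z) < r -> snorm (w + t%:C%C *: v - z) < r.
Proof.
move=> /andP[t0 t1] wr vr.
have -> : w + t%:C%C *: v - z = (1 - t)%:C%C *: (w - z) + t%:C%C *: (w + v - z).
  rewrite -[w + v - z](addrAC w (- z) v) [in RHS](scalerDr t%:C%C) addrA -scalerDl -rmorphD /= subrK.
  by rewrite scale1r addrAC.
apply: le_lt_trans (ler_snormD _ _) _.
rewrite !snormZ !cabs_real !ger0_norm ?subr_ge0 //.
have [t_eq0|tn0] := eqVneq t 0; first by rewrite t_eq0 subr0 mul1r mul0r addr0.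
have tgt0 : 0 < t by rewrite lt0r tn0.
have H1 : (1 - t) * snorm (w - z) <= (1 - t) * r by rewrite ler_wpM2l ?subr_ge0 // ltW.
have H2 : t * snorm (w + v - z) < t * r by rewrite ltr_pM2l.
by lra.
Qed.

(** [B] is chosen before [f], so that one bound serves the whole family; the dichotomy is decided
    for each [f] on the larger ball of radius [eta]. *)
Lemma harnack_ball (F : set ('rV[R[i]^o]_n -> R[i]^o)) z0 (r M alpha : R) :
  0 < r -> 0 <= M -> 0 <= alpha ->
  (forall f w, F f -> snorm (w - z0) < r -> differentiable f w) ->
  (forall f w v, F f -> snorm (w - z0) < r ->
     cabs (Dfv f w v) <= M * snorm v * (1 + cabs (f w) `^ alpha)) ->
  exists2 rho, 0 < rho <= r & forall A, exists B, forall f w z, F f ->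
    snorm (w - z0) < rho -> snorm (z - z0) < rho -> cabs (f w) <= A -> cabs (f z) <= B.
Proof.
move=> r0 M0 alpha0 dF FM.
pose q : R := 1 + 2 `^ alpha; have q0 : 0 < q by rewrite ltr_wpDr ?powR_ge0.
have c0 : 0 < 4 * (M + 1) * q by rewrite !mulr_gt0 // ltr_wpDl.
(* Two points of the ball of radius [eta] are at most [2 * eta] apart; the summand 1 makes the
   growth condition [4 * M * eta * q < 1] strict and keeps the inverse meaningful for [M = 0]. *)
pose eta := Num.min r (4 * (M + 1) * q)^-1.
have eta0 : 0 < eta by rewrite lt_min r0 invr_gt0.
have etar : eta <= r by rewrite ge_min lexx.
have etaM : 2 * (M * (2 * eta)) * q < 1.
  have : eta * (4 * (M + 1) * q) <= 1 by rewrite -ler_pdivlMr // mul1r ge_min lexx orbT.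
  have : 0 < eta * q by exact: mulr_gt0.
  by lra.
have in_r w : snorm (w - z0) < eta -> snorm (w - z0) < r by move=> /lt_le_trans; apply.
(* For [z] and [w] within [eta / 8] of [z0], the disc of radius 3 in the direction [w - z] reaches
   at most [3 * eta / 4] from [z], so it stays in the ball of radius [eta]. *)
exists (eta / 8); first by apply/andP; split; lra.
(* The two terms serve the two cases; in the second, [A > 1] because [A] bounds [cabs (f w)]. *)
move=> A; exists (Num.max 2 (expR (expR 4 * ln A))) => f w z Ff wz zz fA.
have [[w1 [w1z fw1]]|big] := pselect (exists w1, snorm (w1 - z0) < eta /\ cabs (f w1) <= 1).
  rewrite le_max; apply/orP; left; apply: ltW.
  pose v := z - w1.
  have w1v : w1 + v = z by rewrite /v addrC subrK.
  have zeta : snorm (z - z0) < eta by lra.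
  have v2 : snorm v <= 2 * eta.
    apply: le_trans (ler_snorm_dist z z0 w1) _; rewrite (snormB z0).
    by have := ltW w1z; have := ltW zeta; lra.
  have seg (t : R) : 0 <= t <= 1 -> snorm (w1 + t%:C%C *: v - z0) < eta.
    by move=> t01; apply: snorm_convex; rewrite // w1v.
  have := @cabs_lt2_of_growth R (fun t => f (w1 + t%:C%C *: v))
    (fun t => Dfv f (w1 + t%:C%C *: v) v) alpha (M * (2 * eta)) alpha0 etaM.
  rewrite scale0r addr0 scale1r w1v; apply => //.
  - by rewrite mulr_ge0 // mulr_ge0 // ltW.
  - move=> t t01; have dt := dF _ _ Ff (in_r _ (seg t t01)).
    have H := slice_is_cdiff dt (t := t) (g := fun s => s%:C%C) (d := 1) erefl.
    rewrite -[Dfv _ _ _]mulr1; apply: H.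
    by split; [exact: is_derive_id | exact: is_derive_cst].
  - move=> t t01; apply: le_trans (FM _ _ _ Ff (in_r _ (seg t t01))) _.
    by rewrite ler_wpM2r ?addr_ge0 ?powR_ge0 // ler_wpM2l.
have f1 u : snorm (u - z0) < eta -> 1 < cabs (f u).
  by move=> uz; rewrite ltNge; apply/negP => fu; apply: big; exists u.
rewrite le_max; apply/orP; right.
pose v := w - z.
have zv : z + v = w by rewrite /v addrC subrK.
have v8 : snorm v <= eta / 4.
  apply: le_trans (ler_snorm_dist w z0 z) _; rewrite (snormB z0).
  by have := ltW wz; have := ltW zz; lra.
have in_eta h : cabs h <= 3 -> snorm (z + h *: v - z0) < eta.
  move=> h3; rewrite addrAC; apply: le_lt_trans (ler_snormD _ _) _.
  rewrite snormZ; have : cabs h * snorm v <= 3 * (eta / 4).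
    by apply: ler_pM; rewrite ?cabs_ge0 ?snorm_ge0.
  by lra.
have f1z : 1 < cabs (f z) by apply: f1; lra.
have f1w : 1 < cabs (f w) by apply: f1; lra.
have : ln (cabs (f z)) <= expR 4 * ln (cabs (f (z + v))).
  apply: (@segment_harnack _ _ _ _ _ (M * snorm v) alpha) => //.
  - by move=> h h3; apply: dF Ff _; exact/in_r/in_eta.
  - by move=> h h3; exact/f1/in_eta.
  - by move=> h h3; apply: FM => //; exact/in_r/in_eta.
  - by rewrite mulr_ge0 ?snorm_ge0.
rewrite zv => H; rewrite -[leLHS]lnK ?posrE ?(lt_trans ltr01) // ler_expR.
apply: le_trans H _; rewrite ler_pM2l ?expR_gt0 // ler_ln ?posrE ?(lt_trans ltr01) //.
exact: lt_le_trans fA.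
Qed.

(** Local constancy makes both the set where [P] holds and the set where it fails open in [D];
    connectedness leaves only one of them. *)
Lemma connected_local_cst (D : set 'rV[R[i]^o]_n) (P : 'rV[R[i]^o]_n -> Prop) :
  domain D ->
  (forall z0, D z0 -> exists2 r, 0 < r & forall w z,
     snorm (w - z0) < r -> snorm (z - z0) < r -> P w -> P z) ->
  (forall z, D z -> P z) \/ (forall z, D z -> ~ P z).
Proof.
move=> [oD cD] locP.
have [[z1 [Dz1 Pz1]]|none] := pselect (exists z, D z /\ P z); last first.
  by right => z Dz Pz; apply: none; exists z.
left => z Dz.
have near_D z0 : D z0 -> \forall w \near z0, D w by move=> Dz0; exact: open_nbhs_nbhs.
have self (z0 : 'rV[R[i]^o]_n) (r : R) : 0 < r -> snorm (z0 - z0) < r by rewrite subrr snorm0.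
have oB (Q : 'rV[R[i]^o]_n -> Prop) :
    (forall z0, D z0 -> exists2 r, 0 < r & forall w z,
      snorm (w - z0) < r -> snorm (z - z0) < r -> Q w -> Q z) ->
    open (D `&` [set w | Q w]).
  move=> locQ; rewrite openE => z0 [Dz0 /= Qz0].
  have [r r0 Hr] := locQ z0 Dz0.
  apply: filterI; first exact: near_D.
  by apply/nbhs_snorm; exists r => // w wz; apply: Hr Qz0 => //; exact: self.
pose B := D `&` [set w | P w].
have BD : B = D.
  apply: cD; first by exists z1.
  - by exists B; [exact: oB | rewrite /B setIA setIid].
  - exists (~` (D `&` [set w | ~ P w])).
      apply: open_closedC; apply: oB => z0 /locP[r r0 Hr]; exists r => // w u wz uz Pw Pu.
      by apply: Pw; exact: Hr Pu.
    apply/seteqP; split => [w [Dw Pw]|w [Dw nw]]; first by split => // -[_].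
    by split => //; apply: contrapT => nPw; apply: nw.
have Bz : B z by rewrite BD.
by case: Bz.
Qed.

Lemma local_bound (D : set 'rV[R[i]^o]_n) (F : set ('rV[R[i]^o]_n -> R[i]^o)) (alpha : R) z0 :
  open D -> (forall f, F f -> holomorphic_on D f) ->
  loc_unif_bounded D [set F_alpha alpha f | f in F] -> D z0 ->
  exists r M : R, [/\ 0 < r, 0 <= M, forall w, snorm (w - z0) < r -> D w,
    forall f w, F f -> snorm (w - z0) < r -> differentiable f w &
    forall f w v, F f -> snorm (w - z0) < r ->
      cabs (Dfv f w v) <= M * snorm v * (1 + cabs (f w) `^ alpha)].
Proof.
move=> oD hF bF Dz0.
have [M HM] := bF z0 Dz0.
have : \forall w \near z0, D w /\ forall f, F f -> F_alpha alpha f w <= Num.max M 0.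
  have nD : \forall w \near z0, D w by exact: open_nbhs_nbhs.
  apply: filterS (filterI nD HM) => w [/= Dw H]; split => // f Ff.
  by rewrite le_max H //; exists f.
move=> /nbhs_snorm[r r0 Hr]; exists r, (Num.max M 0); split => //.
- by rewrite le_max lexx orbT.
- by move=> w /Hr[].
- by move=> f w Ff /Hr[Dw _]; exact: hF.
- by move=> f w v Ff /Hr[_ H]; apply: Dfv_le; exact: H.
Qed.

End NormalFamily.

Unset Implicit Arguments.

Theorem theorem11 (R : realType) (n : nat) (D : set 'rV[R[i]^o]_n)
  (F : set ('rV[R[i]^o]_n -> R[i]^o)) (alpha : R) :
  domain D ->
  (forall f, F f -> holomorphic_on D f) ->
  0 < alpha ->
  loc_unif_bounded D [set F_alpha alpha f | f in F] ->
  normal_family D F.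
Proof.
move=> domD hF /ltW alpha0 bF f Ff; have [oD cD] := domD.
have [U [UU oU]] := ultraFilterLemma (eventually_filter : ProperFilter \oo).
have UP : ProperFilter U by exact: ultra_proper.
have nbhs_harnack z0 : D z0 -> exists r M : R, [/\ 0 < r, 0 <= M,
    forall w, snorm (w - z0) < r -> D w,
    forall f w, F f -> snorm (w - z0) < r -> differentiable f w &
    (forall f w v, F f -> snorm (w - z0) < r ->
      cabs (Dfv f w v) <= M * snorm v * (1 + cabs (f w) `^ alpha)) /\
    forall A, exists B, forall f w z, F f ->
      snorm (w - z0) < r -> snorm (z - z0) < r -> cabs (f w) <= A -> cabs (f z) <= B].
  move=> Dz0; have [r [M [r0 M0 rD rd rM]]] := local_bound oD hF bF Dz0.
  have [rho /andP[rho0 rhor] H] := harnack_ball r0 M0 alpha0 rd rM.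
  have rr w : snorm (w - z0) < rho -> snorm (w - z0) < r by move=> /lt_le_trans; apply.
  exists rho, M; split => //.
  - by move=> w /rr; exact: rD.
  - by move=> g w Fg /rr; exact: rd.
  - by split => // g w v Fg /rr; exact: rM.
have self (z0 : 'rV[R[i]^o]_n) (r : R) : 0 < r -> snorm (z0 - z0) < r by rewrite subrr snorm0.
(* Boundedness is tested along [U], not along all indices: its failure then means large values along
   [U], and no subsequence has to be extracted before the dichotomy. *)
pose bdd z := exists A : R, U [set k | cabs (f k z) <= A].
have [allb|noneb] : (forall z, D z -> bdd z) \/ (forall z, D z -> ~ bdd z).
- apply: connected_local_cst => // z0 /nbhs_harnack[r [M [r0 _ _ _ [_ H]]]].
  exists r => // w z wz zz [A HA]; have [B HB] := H A; exists B.
  by apply: filterS HA => k /=; exact: HB.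
(* The pointwise ultralimit; off [D] any value will do. *)
- have /choice[g Hg] : forall z, exists l, D z -> forall e, 0 < e -> U [set k | cabs (f k z - l) < e].
    move=> z; have [Dz|nDz] := pselect (D z); last by exists 0.
    by have [A /ultra_limit_complex[l Hl]] := allb z Dz; exists l.
  have [z0 Dz0|phi [phiS Hphi]] := @ultra_subsequence R n D U
    (fun j k w => cabs (f k w - g w) < j.+1%:R^-1) UP oU; last first.
    exists phi; split => //; left; exists g => K cK KD e e0.
    have [j je] : exists j : nat, j.+1%:R^-1 < e.
      exists (Num.truncn e^-1); rewrite invf_plt ?posrE ?ltr0n //.
      by have /andP[] := truncn_itv (ltW (ltac:(by rewrite invr_gt0) : 0 < e^-1)).
    by apply: filterS (Hphi K cK KD j) => m H z /H /lt_trans; apply.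
  have [r [M [r0 M0 rD rd [rM H]]]] := nbhs_harnack z0 Dz0.
  have [A HA] := allb z0 Dz0; have [B HB] := H A.
  (* A Lipschitz constant on the ball for every [f k] bounded by [A] at [z0]: these [f k] are
     bounded by [B], which makes the gradient bound uniform, and the factor 2 comes from
     [segment_lipschitz]. *)
  pose C := 2 * (M * (1 + B `^ alpha)).
  have C0 : 0 <= C by rewrite mulr_ge0 // mulr_ge0 // addr_ge0 ?powR_ge0.
  have fB k : cabs (f k z0) <= A -> forall w, snorm (w - z0) < r -> cabs (f k w) <= B.
    by move=> kA w wz; apply: (HB (f k) z0) => //; exact: self.
  have fL k : cabs (f k z0) <= A -> forall w z, snorm (w - z0) < r -> snorm (z - z0) < r ->
      cabs (f k z - f k w) <= C * snorm (z - w).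
    move=> kA w z wz zz; pose v := z - w.
    have wv : w + v = z by rewrite /v addrC subrK.
    have seg (t : R) : 0 <= t <= 1 -> snorm (w + t%:C%C *: v - z0) < r.
      by move=> t01; apply: snorm_convex; rewrite // wv.
    have := @segment_lipschitz R n (f k) w v (M * snorm v * (1 + B `^ alpha)).
    rewrite wv /C (_ : 2 * (M * (1 + B `^ alpha)) * _ = 2 * (M * snorm v * (1 + B `^ alpha))); last first.
      by rewrite /v; ring.
    apply => t t01; first by apply: rd (Ff k) _; exact: seg.
    apply: le_trans (rM _ _ _ (Ff k) (seg t t01)) _.
    rewrite ler_wpM2l ?mulr_ge0 ?snorm_ge0 // lerD2l ge0_ler_powR ?nnegrE ?cabs_ge0 //.
      by apply: le_trans (fB k kA _ (seg t t01)); exact: cabs_ge0.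
    exact: fB (seg t t01).
  have gL w z : snorm (w - z0) < r -> snorm (z - z0) < r -> cabs (g z - g w) <= C * snorm (z - w).
    move=> wz zz; apply/ler_addgt0Pl => e e0; have e20 : 0 < e / 2 by rewrite divr_gt0.
    have [k [/= kA [/= kz kw]]] := filter_ex (filterI HA
      (filterI (Hg z (rD z zz) _ e20) (Hg w (rD w wz) _ e20))).
    apply: le_trans (ler_cabs_dist _ _ (f k z)) _; rewrite cabsB.
    have := ler_cabs_dist (f k z) (g w) (f k w).
    by have := fL k kA w z wz zz; lra.
  (* Half the radius keeps the ultralimit of points of the small ball inside the ball where the
     estimates hold. *)
  exists (r / 2) => [|j]; first by rewrite divr_gt0.
  set e : R := j.+1%:R^-1; have e0 : 0 < e by rewrite invr_gt0 ltr0n.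
  have [//|/= Uc] := in_ultra_setVsetC
    [set k | forall w, snorm (w - z0) < r / 2 -> cabs (f k w - g w) < e] UU.
  (* [u k] is a point where the approximation fails by at least [e], if there is one, and an
     arbitrary point of the small ball otherwise. *)
  have /choice[u Hu] : forall k, exists w, snorm (w - z0) < r / 2 /\
      ((exists w, snorm (w - z0) < r / 2 /\ e <= cabs (f k w - g w)) -> e <= cabs (f k w - g w)).
    move=> k; have [[w [wr we]]|no] := pselect (exists w, snorm (w - z0) < r / 2 /\ e <= cabs (f k w - g w)).
      by exists w.
    by exists z0; split; [apply: self; rewrite divr_gt0 | move=> /no].
  have [l Hl] : exists l, forall d, 0 < d -> U [set k | snorm (u k - l) < d].
    apply: (@ultra_limit_row _ _ _ _ u (r / 2 + snorm z0)); apply: filterS filterT => k _ /=.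
    rewrite -[u k](subrK z0); apply: le_trans (ler_snormD _ _) _.
    by rewrite lerD2r ltW //; case: (Hu k).
  have r4 : 0 < r / 4 by rewrite divr_gt0.
  have lr : snorm (l - z0) < r.
    have [k /= kl] := filter_ex (Hl _ r4); have [uk _] := Hu k.
    apply: le_lt_trans (ler_snorm_dist _ (u k) _) _; rewrite snormB.
    by lra.
  (* For a suitable [k], the error at [u k] is at most two Lipschitz moves between [u k] and [l]
     plus the error at [l]. Each is at most [e / 4], against an error of at least [e]. *)
  have e4 : 0 < e / 4 by rewrite divr_gt0.
  have d0 : 0 < e / 4 / (C + 1) by rewrite divr_gt0 // ltr_wpDl.
  have [k [/= kA [/= kc [/= kl kg]]]] := filter_ex (filterI HA (filterI Uc
    (filterI (Hl _ d0) (Hg l (rD l lr) _ e4)))).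
  have [uk ek] := Hu k.
  have ukr : snorm (u k - z0) < r by lra.
  have fe : e <= cabs (f k (u k) - g (u k)).
    apply: ek; move/existsNP: kc => [w /not_implyP[wr /negP]].
    by rewrite -leNgt => we; exists w.
  have Ce : C * snorm (u k - l) <= e / 4.
    move: kl; rewrite ltr_pdivlMr ?ltr_wpDl // mulrDr mulr1 mulrC.
    by have := snorm_ge0 (u k - l); lra.
  have := fL k kA l (u k) lr ukr; have := gL (u k) l ukr lr; rewrite (snormB l).
  have := ler_cabs_dist (f k (u k)) (g (u k)) (f k l).
  have := ler_cabs_dist (f k l) (g (u k)) (g l).
  by lra.
- have [z0 Dz0|phi [phiS Hphi]] := @ultra_subsequence R n D U
    (fun j k w => j%:R < cabs (f k w)) UP oU; last first.
    exists phi; split => //; right => K cK KD M.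
    have [j jM] : exists j : nat, M < j%:R.
      exists (Num.truncn `|M|).+1; apply: le_lt_trans (ler_norm M) _.
      by have /andP[] := truncn_itv (normr_ge0 M).
    by apply: filterS (Hphi K cK KD j) => m H z /H; exact: lt_trans.
  have [r [M [r0 _ _ _ [_ H]]]] := nbhs_harnack z0 Dz0.
  exists r => // j.
  (* Otherwise, for a set of [k] in [U], some point of the ball has a value of modulus at most [j],
     and the Harnack bound carries this to [z0], against [noneb]. *)
  have [//|/= Uc] := in_ultra_setVsetC [set k | forall w, snorm (w - z0) < r -> j%:R < cabs (f k w)] UU.
  exfalso; apply: (noneb z0 Dz0); have [B HB] := H j%:R; exists B.
  apply: filterS Uc => k /= /existsNP[w /not_implyP[wr /negP]].
  by rewrite -leNgt => fw; apply: (HB (f k) w) => //; exact: self.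
Qed.
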